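(* Let $K\subset\mathbb{R}^d$ be a non-empty compact set and let $A\subset[0,\dim_H K]$. Then the following are equivalent: (1) There is a compact set $\mathcal{C}\subset\mathcal{K}(K)$ with $\{\dim_H C: C\in\mathcal{C}\}=A$; (2) $A$ is an analytic set.
   Context: Here $d\geq 1$ is an integer and $\dim_H$ is Hausdorff dimension. $\mathcal{K}(K)$ denotes the set of non-empty compact subsets of $K$ endowed with the Hausdorff metric; the family $\mathcal{C}$ may be empty. A set $A\subset\mathbb{R}$ is analytic if it is the image of a (possibly empty) Polish space under a continuous map; in particular $\emptyset$ is analytic. *)

(* Defs.v *)
From HB Require Import structures.
From mathcomp Require Import all_boot all_order all_algebra.
From mathcomp Require Import all_classical all_reals all_analysis.
From mathcomp Require Import ring lra.
Import Order.TTheory GRing.Theory Num.Theory.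
Import numFieldNormedType.Exports.

Set Implicit Arguments.
Unset Strict Implicit.
Unset Printing Implicit Defensive.

Local Open Scope classical_set_scope.
Local Open Scope ring_scope.

Section EuclideanDistance.
Context {R : realType} {d : nat}.
Implicit Types x y z : 'rV[R]_d.

(* The norm provided by the library on ['rV[R]_d] is the sup norm. It induces
   the same topology, hence the same compact sets, as this distance. *)
Definition edist x y : R := Num.sqrt (\sum_(i < d) (x 0 i - y 0 i) ^+ 2).

Lemma edist_ge0 x y : 0 <= edist x y.
Proof. exact: sqrtr_ge0. Qed.

Lemma edistxx x : edist x x = 0.
Proof.
by rewrite /edist big1 ?sqrtr0// => i _; rewrite subrr expr0n.
Qed.

Lemma edist_sym x y : edist x y = edist y x.
Proof.
by congr Num.sqrt; apply: eq_bigr => i _; rewrite -sqrrN opprB.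
Qed.

Lemma l2_triangle (a b : 'I_d -> R) :
  Num.sqrt (\sum_i (a i + b i) ^+ 2) <=
  Num.sqrt (\sum_i a i ^+ 2) + Num.sqrt (\sum_i b i ^+ 2).
Proof.
have sq_ge0 (c : 'I_d -> R) : 0 <= \sum_i c i ^+ 2.
  by apply: sumr_ge0 => i _; exact: sqr_ge0.
set al := Num.sqrt (\sum_i a i ^+ 2); set be := Num.sqrt (\sum_i b i ^+ 2).
have al0 : 0 <= al by exact: sqrtr_ge0.
have be0 : 0 <= be by exact: sqrtr_ge0.
have alE : al ^+ 2 = \sum_i a i ^+ 2 by rewrite sqr_sqrtr.
have beE : be ^+ 2 = \sum_i b i ^+ 2 by rewrite sqr_sqrtr.
have null (c : 'I_d -> R) : \sum_i c i ^+ 2 = 0 -> forall i, c i = 0.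
  move=> c0 i; apply/eqP; rewrite -sqrf_eq0.
  move/eqP: c0; rewrite psumr_eq0; last by move=> j _; exact: sqr_ge0.
  by move/allP => /(_ i); rewrite mem_index_enum => /(_ isT).
have cs : \sum_i a i * b i <= al * be.
  have [a0|a0] := eqVneq al 0.
    have /null az : \sum_i a i ^+ 2 = 0 by rewrite -alE a0 expr0n.
    by rewrite a0 mul0r big1// => i _; rewrite az mul0r.
  have [b0|b0] := eqVneq be 0.
    have /null bz : \sum_i b i ^+ 2 = 0 by rewrite -beE b0 expr0n.
    by rewrite b0 mulr0 big1// => i _; rewrite bz mulr0.
  have ab : 0 < al * be by rewrite mulr_gt0// lt0r ?a0 ?b0.
  have := sq_ge0 (fun i => be * a i - al * b i).
  have -> : \sum_i (be * a i - al * b i) ^+ 2 =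
      2 * (al * be) * (al * be - \sum_i a i * b i).
    transitivity (be ^+ 2 * \sum_i a i ^+ 2 + al ^+ 2 * \sum_i b i ^+ 2
                  - 2 * (al * be) * \sum_i a i * b i).
      rewrite !mulr_sumr -big_split/= -sumrB; apply: eq_bigr => i _; ring.
    rewrite -alE -beE; ring.
  have ab2 : 0 < 2 * (al * be) by rewrite mulr_gt0.
  by rewrite (pmulr_rge0 _ ab2) subr_ge0.
rewrite -(ler_pXn2r (n := 2)) ?nnegrE ?sqrtr_ge0 ?addr_ge0//.
rewrite sqr_sqrtr//.
have -> : \sum_i (a i + b i) ^+ 2 =
    al ^+ 2 + be ^+ 2 + 2 * \sum_i a i * b i.
  rewrite alE beE mulr_sumr -!big_split/=; apply: eq_bigr => i _; ring.
nra.
Qed.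

Lemma edist_triangle y x z : edist x z <= edist x y + edist y z.
Proof.
have := l2_triangle (fun i => x 0 i - y 0 i) (fun i => y 0 i - z 0 i).
by under eq_bigr do rewrite addrA subrK.
Qed.

Lemma coord_le_edist x y i : `|x 0 i - y 0 i| <= edist x y.
Proof.
rewrite -sqrtr_sqr ler_wsqrtr// (bigD1 i)//= lerDl.
by apply: sumr_ge0 => j _; exact: sqr_ge0.
Qed.

Lemma edist_ball x y (e : R) : edist x y < e -> ball x e y.
Proof.
move=> xy; split; first exact: le_lt_trans (edist_ge0 x y) xy.
move=> i j; rewrite (ord1 i) /ball/=.
exact: le_lt_trans (coord_le_edist x y j) xy.
Qed.

Lemma edist_le_coord x y (M : R) : 0 <= M ->
  (forall i, `|x 0 i - y 0 i| <= M) -> edist x y <= d%:R * M.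
Proof.
move=> M0 xyM.
suff sub : forall (s : seq 'I_d) (c : 'I_d -> R),
    Num.sqrt (\sum_(i <- s) c i ^+ 2) <= \sum_(i <- s) `|c i|.
  rewrite (le_trans (sub _ _))// (le_trans (ler_sum _ (fun i _ => xyM i)))//.
  by rewrite sumr_const card_ord mulr_natl.
move=> s c; have s0 : 0 <= \sum_(i <- s) `|c i| by apply: sumr_ge0.
rewrite -(ler_pXn2r (n := 2)) ?nnegrE ?sqrtr_ge0//.
rewrite sqr_sqrtr; last by apply: sumr_ge0 => i _; exact: sqr_ge0.
elim: s {s0} => [|i s ih]; first by rewrite !big_nil expr0n.
have s0 : 0 <= \sum_(i <- s) `|c i| by apply: sumr_ge0.
rewrite !big_cons sqrrD real_normK ?num_real// -addrA lerD2l.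
by rewrite (le_trans ih)// lerDr mulrn_wge0// mulr_ge0.
Qed.

End EuclideanDistance.

Section HausdorffDimension.
Context {R : realType} {d : nat}.
Implicit Types (A U : set 'rV[R]_d) (s delta : R).

Definition diam U : \bar R :=
  maxe 0%E (ereal_sup [set (edist p.1 p.2)%:E | p in U `*` U]).

(* [0 `^ 0 = 1], so that the empty set has to be singled out for [s = 0]. *)
Definition diam_pow s U : \bar R :=
  if U == set0 then 0%E else poweR (diam U) s.

Definition hausdorff_content s delta A : \bar R :=
  ereal_inf [set (\sum_(0 <= i <oo) diam_pow s (U i))%E | U in
    [set U : (set 'rV[R]_d)^nat |
      A `<=` \bigcup_i U i /\ forall i, (diam (U i) <= delta%:E)%E]].

(* The supremum over [delta > 0] is the limit as [delta] tends to [0], since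
   [hausdorff_content s delta A] is nonincreasing in [delta]. *)
Definition hausdorff_measure s A : \bar R :=
  ereal_sup [set hausdorff_content s delta A | delta in [set e : R | 0 < e]].

(* A real infimum is enough in ['rV[R]_d]: every [s > d] is in this set. *)
Definition hausdorff_dim A : R :=
  inf [set s | 0 <= s /\ hausdorff_measure s A = 0%E].

End HausdorffDimension.

Section Hyperspace.
Context {R : realType} {d : nat}.
Implicit Types A B C K : set 'rV[R]_d.

Definition closed_nbhd A (e : R) : set 'rV[R]_d :=
  [set x | exists2 a, A a & edist x a <= e].

Definition hausdorff_radii A B : set R :=
  [set e | [/\ 0 <= e, A `<=` closed_nbhd B e & B `<=` closed_nbhd A e]].

Definition hausdorff_dist A B : R := inf (hausdorff_radii A B).

Definition hyperspace K : Type :=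
  set_type [set C | [/\ C !=set0, compact C & C `<=` K]].

HB.instance Definition _ K := Choice.on (hyperspace K).

Definition carrier K (C : hyperspace K) : set 'rV[R]_d := val C.

Lemma carrierP K (C : hyperspace K) :
  [/\ carrier C !=set0, compact (carrier C) & carrier C `<=` K].
Proof. by have := set_mem (valP C). Qed.

Lemma carrier_inj K : injective (@carrier K).
Proof. exact: val_inj. Qed.

Lemma compact_coord_bounded A : compact A ->
  exists2 M : R, 0 <= M & forall x, A x -> forall i, `|x 0 i| <= M.
Proof.
move=> cA.
have bnd (i : 'I_d) : exists M : R, forall x, A x -> `|x 0 i| <= M.
  have cc : compact ((fun x : 'rV[R]_d => x 0 i) @` A).
    apply: continuous_compact => //; apply: continuous_subspaceT => x.
    exact: coord_continuous.
  have [M [_ /(_ (M + 1))]] := compact_bounded cc.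
  rewrite ltrDl ltr01 => /(_ isT) MP; exists (M + 1) => x Ax.
  by apply: MP; exists x.
have [f fP] := choice bnd.
exists (\sum_i `|f i|); first by apply: sumr_ge0.
move=> x Ax i; rewrite (le_trans (fP i x Ax))//.
rewrite (le_trans (ler_norm _))// (bigD1 i)//= lerDl.
by apply: sumr_ge0.
Qed.

Lemma hausdorff_radii_nonempty K (A B : hyperspace K) :
  hausdorff_radii (carrier A) (carrier B) !=set0.
Proof.
have [[a Aa] cA _] := carrierP A; have [[b Bb] cB _] := carrierP B.
have [M M0 MP] := compact_coord_bounded cA.
have [N N0 NP] := compact_coord_bounded cB.
have MN x y : carrier A x -> carrier B y -> edist x y <= d%:R * (M + N).
  move=> Ax By; apply: edist_le_coord; first exact: addr_ge0.
  by move=> i; rewrite (le_trans (ler_normB _ _))// lerD ?MP ?NP.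
exists (d%:R * (M + N)); split.
- by rewrite mulr_ge0// addr_ge0.
- by move=> x Ax; exists b => //; exact: MN.
- by move=> y By; exists a => //; rewrite edist_sym; exact: MN.
Qed.

Lemma hausdorff_radii_has_inf K (A B : hyperspace K) :
  has_inf (hausdorff_radii (carrier A) (carrier B)).
Proof.
split; first exact: hausdorff_radii_nonempty.
by exists 0 => e [].
Qed.

Lemma closed_nbhd_closure A B : (forall e : R, 0 < e -> A `<=` closed_nbhd B e) ->
  A `<=` closure B.
Proof.
move=> AB x Ax V /nbhs_ballP[e /= e0 eV].
have /AB/(_ x Ax)[b Bb xb] : 0 < e / 2 by rewrite divr_gt0.
exists b; split => //; apply: eV; apply: edist_ball.
by rewrite (le_lt_trans xb)// gtr_pMr// invf_lt1// ltr1n.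
Qed.

Lemma closed_nbhdS A (e e' : R) : e <= e' -> closed_nbhd A e `<=` closed_nbhd A e'.
Proof. by move=> ee x [a Aa xa]; exists a => //; exact: le_trans ee. Qed.

Definition hyperspace_dist K (A B : hyperspace K) : R :=
  hausdorff_dist (carrier A) (carrier B).

Lemma hyperspace_distxx K (A : hyperspace K) : hyperspace_dist A A = 0.
Proof.
apply/eqP; rewrite eq_le; apply/andP; split.
- apply: ge_inf; first by exists 0 => e [].
  by split=> // x Ax; exists x => //; rewrite edistxx.
- apply: lb_le_inf; first exact: hausdorff_radii_nonempty.
  by move=> e [].
Qed.

Lemma hyperspace_dist_sym K (A B : hyperspace K) :
  hyperspace_dist A B = hyperspace_dist B A.
Proof.
rewrite /hyperspace_dist /hausdorff_dist; congr inf.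
by apply/seteqP; split=> e [? ? ?]; split.
Qed.

Lemma closed_nbhdD A B C (e e' : R) :
  A `<=` closed_nbhd B e -> B `<=` closed_nbhd C e' ->
  A `<=` closed_nbhd C (e + e').
Proof.
move=> AB BC x /AB[y /BC[z Cz yz] xy]; exists z => //.
by rewrite (le_trans (edist_triangle y _ _))// lerD.
Qed.

Lemma hyperspace_dist_triangle K (B A C : hyperspace K) :
  hyperspace_dist A C <= hyperspace_dist A B + hyperspace_dist B C.
Proof.
apply/ler_addgt0Pl => /= e e0.
have e20 : 0 < e / 2 by rewrite divr_gt0.
have [r [r0 AB BA] rlt] := inf_adherent e20 (hausdorff_radii_has_inf A B).
have [q [q0 BC CB] qlt] := inf_adherent e20 (hausdorff_radii_has_inf B C).
apply: (@le_trans _ _ (r + q)).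
  apply: ge_inf; first by exists 0 => u [].
  split; first exact: addr_ge0.
  - exact: closed_nbhdD AB BC.
  - by rewrite addrC; exact: closed_nbhdD CB BA.
apply: (le_trans (ltW (ltrD rlt qlt))).
by rewrite addrACA -splitr addrC.
Qed.

Lemma hyperspace_dist_eq0 K (A B : hyperspace K) :
  hyperspace_dist A B = 0 -> A = B.
Proof.
move=> AB0; apply: carrier_inj.
have close e : 0 < e -> carrier A `<=` closed_nbhd (carrier B) e /\
                        carrier B `<=` closed_nbhd (carrier A) e.
  move=> e0; have [r [r0 AB BA]] := inf_adherent e0 (hausdorff_radii_has_inf A B).
  rewrite -[inf _]/(hyperspace_dist A B) AB0 add0r => /ltW re.
  by split; [move=> x /AB|move=> x /BA]; exact: closed_nbhdS.
have clo (C : hyperspace K) : closed (carrier C).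
  have [_ cC _] := carrierP C; apply: compact_closed cC.
  exact: norm_hausdorff.
apply/seteqP; split.
- rewrite [X in _ `<=` X]((closure_id _).1 (clo B)).
  by apply: closed_nbhd_closure => e /close[].
- rewrite [X in _ `<=` X]((closure_id _).1 (clo A)).
  by apply: closed_nbhd_closure => e /close[].
Qed.

HB.instance Definition _ K := @isMetric.Build R (hyperspace K)
  (@hyperspace_dist K) (@hyperspace_distxx K) (@hyperspace_dist_eq0 K)
  (@hyperspace_dist_sym K) (@hyperspace_dist_triangle K).

End Hyperspace.

Section Analytic.
Context {R : realType}.

Definition separable (T : topologicalType) : Prop :=
  exists2 D : set T, countable D & dense D.

(* The library's [completeType] is pointed, which would exclude the empty
   space, so completeness is spelled out. *)
Definition complete_space (T : uniformType) : Prop :=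
  forall F : set_system T, ProperFilter F -> cauchy F -> exists x : T, F --> x.

Definition polish_metric (X : metricType R) : Prop :=
  complete_space X /\ separable X.

(* A Polish space is a space carrying a complete separable metric; the choice of
   that metric is immaterial for the continuity of [f]. *)
Definition analytic (A : set R) : Prop :=
  exists (X : metricType R) (f : X -> R),
    [/\ polish_metric X, continuous f & range f = A].

End Analytic.

(* Main.v *)
(**
The Hausdorff-null condition H^s(C) = 0 means that for every j there is a cover
with sum of s-th powers of diameters below 1/j, which is an open condition on a
compact set C.  Hence the graph of dim_H over a compact family is an
F_sigma_delta set, and its projection is the continuous image of a closed subset
of the Baire space.

Conversely, let A be the image of a Polish space X under f.  A Cantor scheme
assigns to every binary word w a closed set S_w in X with a chosen point z_w,
where zeros do not change the set and ones make it small.  Fix a point p of K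
around which K has full dimension at every scale, and choose compact subsets
B_w, F_w of K within 2^-|w| of p, with dim B_w = inf f(S_w) and
dim F_w = f(z_w).  To y in the Cantor space associate the union of {p}, of the
B_w over the prefixes w of y, and, for every prefix w, of F_w if y vanishes after
w and of a fine finite subset of F_w otherwise, the finer the later the next one
occurs.  This union depends continuously on y.  If y has infinitely many ones,
S_w shrinks to a point x and the dimension is sup inf f(S_w) = f(x); otherwise it
is f(z_w) for the prefix w ending at the last one.  In both cases it lies in A.

Compact subsets of any dimension t between 0 and dim_H K come from dyadic trees:
the t-dimensional net content of a tree is a limit of capped flows, and for a
tree minimal among those of at least a given content the caps are never needed,
so that the content is an additive mass, i.e. a positive finite t-dimensional
net measure.
*)

Require Import Defs.
From HB Require Import structures.
From mathcomp Require Import all_boot all_order all_algebra.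
From mathcomp Require Import all_classical all_reals all_analysis.
From mathcomp Require Import ring lra zify.
Import Order.TTheory GRing.Theory Num.Theory.
Import numFieldNormedType.Exports.
(* The library also has an [edist], which would otherwise shadow the Euclidean
   distance. *)
Import Defs.

Set Implicit Arguments.
Unset Strict Implicit.
Unset Printing Implicit Defensive.

Local Open Scope classical_set_scope.
Local Open Scope ring_scope.

(** * Hausdorff-null sets *)

Section Null.
Context {R : realType} {d : nat}.
Implicit Types (A B U : set 'rV[R]_d) (s e r : R).

Lemma diam_leP U r : 0 <= r ->
  (diam U <= r%:E)%E <-> (forall x y, U x -> U y -> edist x y <= r).
Proof.
move=> r0; rewrite /diam ge_max lee_fin r0/=; split.
  move=> h x y Ux Uy; rewrite -lee_fin; apply: le_trans h.
  by apply: ereal_sup_ubound; exists (x, y).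
move=> h; apply: ge_ereal_sup => _ [[x y] /= [Ux Uy] <-].
by rewrite lee_fin; exact: h.
Qed.

Lemma diam_ge0 U : (0 <= diam U)%E.
Proof. by rewrite /diam le_max lexx. Qed.

Lemma diam_pow_ge0 s U : (0 <= diam_pow s U)%E.
Proof. by rewrite /diam_pow; case: ifP => // _; exact: poweR_ge0. Qed.

(** Real numbers [r i] bounding the diameters and bounded partial sums replace the extended-real
    series; the size of the pieces is left free. *)
Definition content_le s e A := exists U : nat -> set 'rV[R]_d,
  exists r : nat -> R, [/\ A `<=` \bigcup_i U i,
    forall i, 0 <= r i,
    forall i x y, U i x -> U i y -> edist x y <= r i &
    forall n, \sum_(i < n) r i `^ s <= e].

Definition null s A := forall e, 0 < e -> content_le s e A.

(** In a cover whose total is at most the [s]-th power of [dl] no radius exceeds [dl], so for null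
    sets the restriction to small scales is automatic. *)
Lemma hausdorff_measure_eq0 s A : 0 < s ->
  hausdorff_measure s A = 0%E <-> null s A.
Proof.
move=> s0.
have s1 : s != 0 by rewrite gt_eqF.
have cge0 dl : (0 <= hausdorff_content s dl A)%E.
  apply: le_ereal_inf_tmp => _ [U _ <-].
  by apply: nneseries_ge0 => i _ _; exact: diam_pow_ge0.
split=> [H e e0|H].
  have H1 : (hausdorff_content s 1 A <= 0)%E.
    by rewrite -H; apply: ereal_sup_ubound; exists 1 => //=.
  have : (hausdorff_content s 1 A < e%:E)%E by rewrite (le_lt_trans H1)// lte_fin.
  move/ereal_inf_lt => [_ [U [AU dU] <-] Ue].
  have fdU i : (diam (U i)) \is a fin_num.
    by rewrite ge0_fin_numE ?diam_ge0// (le_lt_trans (dU i))// ltry.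
  exists U, (fun i => if U i == set0 then 0 else fine (diam (U i))); split => //.
  - by move=> i; case: ifP => // _; rewrite fine_ge0// diam_ge0.
  - move=> i x y Ux Uy; case: ifP => [/eqP U0|_]; first by rewrite U0 in Ux.
    move: x y Ux Uy; apply/diam_leP; first by rewrite fine_ge0// diam_ge0.
    by rewrite fineK.
  - move=> n; rewrite -lee_fin; apply: le_trans (ltW Ue).
    rewrite -sumEFin; apply: le_trans (nneseries_lim_ge n _); last first.
      by move=> i _ _; exact: diam_pow_ge0.
    rewrite big_mkord; apply: lee_sum => i _; rewrite /diam_pow.
    case: ifP => _; first by rewrite powR0.
    by rewrite -[in leRHS](fineK (fdU i)) poweR_EFin.
apply/eqP; rewrite eq_le; apply/andP; split; last first.
  by apply: (le_trans (cge0 1)); apply: ereal_sup_ubound; exists 1 => //=.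
apply: ge_ereal_sup => _ [dl /= dl0 <-].
apply/lee_addgt0Pr => e e0; rewrite add0e.
have me0 : 0 < Num.min e (dl `^ s) by rewrite lt_min e0 powR_gt0.
have [U [r [AU r0 dU Sr]]] := H _ me0.
have rdl i : r i <= dl.
  rewrite leNgt; apply/negP => dr.
  have := Sr i.+1; rewrite le_min => /andP[_]; rewrite big_ord_recr/= leNgt => /negP.
  apply; rewrite ltr_wpDl ?sumr_ge0//; first by move=> j _; exact: powR_ge0.
  by apply: gt0_ltr_powR => //; rewrite nnegrE// ltW.
apply: (@le_trans _ _ (\sum_(0 <= i <oo) diam_pow s (U i))%E).
  apply: ereal_inf_lbound; exists U => //; split => // i.
  apply: (@le_trans _ _ (r i)%:E); last by rewrite lee_fin.
  by apply/diam_leP => //; exact: dU.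
apply: lime_le; first by apply: is_cvg_nneseries => i _ _; exact: diam_pow_ge0.
near=> n; apply: (@le_trans _ _ (\sum_(i < n) r i `^ s)%:E); last first.
  by rewrite lee_fin (le_trans (Sr n))// ge_min lexx.
rewrite big_mkord -sumEFin; apply: lee_sum => i _; rewrite /diam_pow.
case: ifP => [_|U0]; first by rewrite lee_fin powR_ge0.
have dr : (diam (U i) <= (r i)%:E)%E by apply/diam_leP => //; exact: dU.
have fd : diam (U i) \is a fin_num.
  by rewrite ge0_fin_numE ?diam_ge0// (le_lt_trans dr)// ltry.
rewrite -(fineK fd) poweR_EFin lee_fin ge0_ler_powR ?nnegrE ?fine_ge0 ?diam_ge0//.
  exact: ltW.
by rewrite -lee_fin fineK.
Unshelve. all: by end_near. Qed.

Lemma content_leS s e A B : A `<=` B -> content_le s e B -> content_le s e A.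
Proof. by move=> AB [U [r [BU r0 dU Sr]]]; exists U, r; split => // x /AB/BU. Qed.

Lemma content_le_le s e e' A : e <= e' -> content_le s e A -> content_le s e' A.
Proof.
move=> ee [U [r [BU r0 dU Sr]]]; exists U, r; split => // n.
exact: le_trans ee.
Qed.

Lemma nullS s A B : A `<=` B -> null s B -> null s A.
Proof. by move=> AB nB e e0; apply: content_leS AB _; exact: nB. Qed.

(** A total of at most 1 forces all radii to be at most 1, and there powers decrease as the exponent
    grows. *)
Lemma null_le s s' A : 0 < s -> s <= s' -> null s A -> null s' A.
Proof.
move=> s0 ss nA e e0.
have me0 : 0 < Num.min e 1 by rewrite lt_min e0/=.
have [U [r [BU r0 dU Sr]]] := nA _ me0; exists U, r; split => // n.
have r1 i : r i <= 1.
  rewrite leNgt; apply/negP => dr.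
  have := Sr i.+1; rewrite le_min => /andP[_]; rewrite big_ord_recr/= leNgt => /negP.
  apply; rewrite ltr_wpDl ?sumr_ge0//; first by move=> j _; exact: powR_ge0.
  rewrite [X in X < _](_ : _ = 1 `^ s); last by rewrite powR1.
  by apply: gt0_ltr_powR => //; rewrite nnegrE// ltW.
apply: (@le_trans _ _ (\sum_(i < n) r i `^ s)); last first.
  by apply: (le_trans (Sr n)); rewrite ge_min lexx.
apply: ler_sum => i _; have [->|ri] := eqVneq (r i) 0.
  by rewrite !powR0 ?gt_eqF// (lt_le_trans s0).
by apply: ger_powR => //; rewrite lt0r ri r0 r1.
Qed.


Lemma sum_geometric_half e n : \sum_(i < n) e / 2 ^+ i.+1 = e - e / 2 ^+ n.
Proof.
elim: n => [|n ih]; first by rewrite big_ord0 expr0 divr1 subrr.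
by rewrite big_ord_recr/= ih exprS; field; rewrite expf_neq0.
Qed.

Lemma sum_geometric_half_le e n : 0 <= e -> \sum_(i < n) e / 2 ^+ i.+1 <= e.
Proof.
by move=> e0; rewrite sum_geometric_half gerBl divr_ge0// exprn_ge0.
Qed.

(** A finite set of pairs lies in a square, whose rows are bounded one by one. This serves for
    double-indexed covers arranged in one sequence. *)
Lemma ler_sum_uniq_pair (f : nat * nat -> R) (l : seq (nat * nat)) (e : nat -> R) :
  (forall p, 0 <= f p) -> uniq l ->
  (forall i n, \sum_(j < n) f (i, j : nat) <= e i) ->
  exists m, \sum_(p <- l) f p <= \sum_(i < m) e i.
Proof.
move=> f0 ul fe.
pose M := (\max_(p <- l) maxn p.1 p.2).+1.
pose P := [seq (i, j) | i <- index_iota 0 M, j <- index_iota 0 M].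
have lP p : p \in l -> p \in P.
  move=> pl; have : (maxn p.1 p.2 < M)%N by rewrite ltnS; exact: leq_bigmax_seq.
  case: p pl => i j pl; rewrite gtn_max => /andP[iM jM].
  by apply/allpairsP; exists (i, j); split => //; rewrite mem_index_iota.
have uP : uniq P.
  by apply: allpairs_uniq; rewrite ?iota_uniq// => -[? ?] [? ?].
have pl : perm_eq l [seq p <- P | p \in l].
  apply: uniq_perm => //; first exact: filter_uniq.
  by move=> p; rewrite mem_filter; case: (boolP (p \in l)) => //= /lP ->.
exists M; rewrite (perm_big _ pl) big_filter big_mkcond.
apply: (@le_trans _ _ (\sum_(p <- P) f p)).
  by apply: ler_sum => p _; case: ifP.
rewrite big_allpairs big_mkord; apply: ler_sum => i _.
by rewrite big_mkord; exact: fe.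
Qed.

Lemma null_bigcup s (F : nat -> set 'rV[R]_d) :
  0 < s -> (forall i, null s (F i)) -> null s (\bigcup_i F i).
Proof.
move=> s0 nF e e0.
have /choice[U /choice[r Ur]] : forall i, exists U : nat -> set 'rV[R]_d,
    exists r : nat -> R, [/\ F i `<=` \bigcup_i U i, forall i, 0 <= r i,
    forall i x y, U i x -> U i y -> edist x y <= r i &
    forall n, \sum_(j < n) r j `^ s <= e / 2 ^+ i.+1].
  by move=> i; apply: nF; rewrite divr_gt0// exprn_gt0.

(* The covers, with budget [e / 2 ^+ i.+1] in row [i], are arranged along [pickle]; numbers coding
   no pair get the empty piece and radius 0. *)
pose U' n := oapp (fun p : nat * nat => U p.1 p.2) set0 (pickle_inv n).
exists U', (fun n => oapp (fun p : nat * nat => r p.1 p.2) 0 (pickle_inv n)).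
split.
- move=> x [i _ Fx]; have [/(_ x Fx)[j _ Ux] _ _ _] := Ur i.
  by exists (pickle (i, j)) => //; rewrite /U' pickleK_inv.
- move=> n; case: pickle_inv => //= -[i j] /=.
  by have [_ ? _ _] := Ur i.
- move=> n x y; rewrite /U'; case: pickle_inv => //= -[i j] /=.
  by have [_ _ + _] := Ur i; apply.
move=> n; pose f (p : nat * nat) := r p.1 p.2 `^ s.
have [m] := @ler_sum_uniq_pair f (pmap (@pickle_inv (nat * nat)%type) (iota 0 n)) 
  (fun i => e / 2 ^+ i.+1) (fun p => powR_ge0 _ _)
  (pmap_uniq (@pickle_invK _) (iota_uniq 0 n)) 
  (fun i => let: And4 _ _ _ h := Ur i in h).
rewrite big_pmap -[X in iota _ X](subn0 n) big_mkord => fm.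
apply: (le_trans _ (le_trans fm (sum_geometric_half_le _ (ltW e0)))).
apply: ler_sum => i _; case: pickle_inv => //=.
by rewrite powR0// gt_eqF.
Qed.

Lemma nbhs_edist (x : 'rV[R]_d) e : 0 < e -> nbhs x [set y | edist x y < e].
Proof.
move=> e0; apply/nbhs_ballP; exists (e / d.+1%:R) => /=; first by rewrite divr_gt0.
move=> y [_ xy]; apply: (@le_lt_trans _ _ (d%:R * (e / d.+1%:R))).
  apply: edist_le_coord; first by rewrite divr_ge0// ltW.
  by move=> i; apply/ltW; exact: xy.
by rewrite mulrCA gtr_pMr// ltr_pdivrMr// mul1r ltr_nat.
Qed.

Lemma nbhs_edistP (x : 'rV[R]_d) (P : set 'rV[R]_d) :
  nbhs x P <-> exists2 e, 0 < e & [set y | edist x y < e] `<=` P.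
Proof.
split; last by move=> [e e0 eP]; apply: filterS eP _; exact: nbhs_edist.
move=> /nbhs_ballP[e /= e0 eP]; exists e => // y xy; apply: eP.
exact: edist_ball.
Qed.

(** Raise the [s]-th power of [r i] by [eta / 2 ^+ i.+1] and fatten the piece by half the resulting
    gap in radius. The new radii are positive even where the old ones vanish. *)
Lemma content_le_open s e eta A : 0 < s -> 0 < eta -> content_le s e A ->
  exists U : nat -> set 'rV[R]_d, exists r : nat -> R,
  [/\ A `<=` \bigcup_i U i, forall i, open (U i),
    forall i, 0 < r i,
    forall i x y, U i x -> U i y -> edist x y <= r i &
    forall n, \sum_(i < n) r i `^ s <= e + eta].
Proof.
move=> s0 eta0 [U [r [AU r0 dU Sr]]].
have s1 : s != 0 by rewrite gt_eqF.
pose r' i := (r i `^ s + eta / 2 ^+ i.+1) `^ s^-1.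
have r'E i : r' i `^ s = r i `^ s + eta / 2 ^+ i.+1.
  rewrite /r' -powRrM mulVf// powRr1// addr_ge0 ?powR_ge0//.
  by rewrite divr_ge0 ?exprn_ge0// ltW.
have r'0 i : 0 <= r' i by exact: powR_ge0.
have rr' i : r i < r' i.
  rewrite ltNge; apply/negP => rr.
  have : r' i `^ s <= r i `^ s by rewrite ge0_ler_powR ?nnegrE// ltW.
  by rewrite r'E leNgt ltrDl divr_gt0// exprn_gt0.
exists (fun i => [set x | exists2 u, U i u & edist u x < (r' i - r i) / 2]), r'.
split => //.
- move=> x /AU[i _ Ux]; exists i => //; exists x => //.
  by rewrite edistxx divr_gt0// subr_gt0.
- move=> i; rewrite openE => x [u Uu ux]; apply/nbhs_edistP.
  exists ((r' i - r i) / 2 - edist u x); first by rewrite subr_gt0.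
  move=> y /= xy; exists u => //.
  by rewrite (le_lt_trans (edist_triangle x _ _))// -ltrBrDl.
- by move=> i; exact: le_lt_trans (rr' i).
- move=> i x y [u Uu ux] [v Uv vy].
  have := edist_triangle u x y; have := edist_triangle v u y.
  have := dU i u v Uu Uv; rewrite (edist_sym x u); lra.
- move=> n; under eq_bigr do rewrite r'E.
  by rewrite big_split/=; apply: lerD; [exact: Sr|exact/sum_geometric_half_le/ltW].
Qed.

Lemma null_dim_le s A : 0 < s -> null s A -> hausdorff_dim A <= s.
Proof.
move=> s0 nA; apply: ge_inf; first by exists 0 => x [].
by split; [exact: ltW|exact/hausdorff_measure_eq0].
Qed.

Lemma hausdorff_dim_ge0 A : 0 <= hausdorff_dim A.
Proof.
rewrite /hausdorff_dim; set E := (X in inf X).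
have [->|/set0P E0] := eqVneq E set0; first by rewrite inf0.
by apply: lb_le_inf => // x [].
Qed.

Lemma lt_dim_not_null s A : 0 < s -> s < hausdorff_dim A -> ~ null s A.
Proof. by move=> s0 + nA; rewrite ltNge null_dim_le. Qed.

(** At exponent 0 every non-empty piece contributes 1, so a content below 1 leaves only empty
    pieces. This settles the exponent that [hausdorff_measure_eq0] excludes. *)
Lemma hausdorff_measure0_eq0 A : hausdorff_measure 0 A = 0%E -> A = set0.
Proof.
move=> H.
have H1 : (hausdorff_content 0 1 A < 1)%E.
  apply: (@le_lt_trans _ _ 0%E); last by rewrite lte_fin.
  by rewrite -H; apply: ereal_sup_ubound; exists 1 => //=.
have [_ [U [AU dU] <-] Ue] := ereal_inf_lt H1.
apply/seteqP; split => // x /AU[i _ Ux].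
suff : (1 <= \sum_(0 <= i <oo) diam_pow 0 (U i))%E by rewrite leNgt Ue.
apply: le_trans (nneseries_lim_ge i.+1 _); last first.
  by move=> j _ _; exact: diam_pow_ge0.
rewrite big_nat_recr//= [X in (_ <= _ + X)%E]/diam_pow.
case: ifPn => [/eqP U0|_]; first by rewrite U0 in Ux.
by rewrite poweRe0 leeDr// sume_ge0// => j _; exact: diam_pow_ge0.
Qed.

(** The hypothesis [null M A] makes the set under the infimum non-empty; the infimum of an empty set
    is 0 by convention and would say nothing. *)
Lemma dim_lt_null M s A : 0 < M -> null M A -> hausdorff_dim A < s -> null s A.
Proof.
move=> M0 nM /inf_lt -/(_ _)[|t [t0 Ht] ts].
  by exists M; split; [exact: ltW|exact/hausdorff_measure_eq0].
move: t0; rewrite le_eqVlt => /predU1P[t0|t0]; last first.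
  by apply: (null_le t0 (ltW ts)); exact/hausdorff_measure_eq0.
move: Ht; rewrite -t0 => /hausdorff_measure0_eq0 -> e e0.
exists (fun=> set0), (fun=> 0); split => // n.
by rewrite big1 ?ltW// => i _; rewrite powR0// gt_eqF// t0.
Qed.

Lemma hausdorff_dim_eq a A : 0 <= a -> (forall s, a < s -> null s A) ->
  (forall s, 0 < s -> s < a -> ~ null s A) -> hausdorff_dim A = a.
Proof.
move=> a0 aA Aa; apply/eqP; rewrite eq_le; apply/andP; split.
  apply/ler_addgt0Pr => e e0; apply: null_dim_le; first by rewrite ltr_wpDl.
  by apply: aA; rewrite ltrDl.
rewrite leNgt; apply/negP => dA.
have d0 := hausdorff_dim_ge0 A.
apply: (Aa ((hausdorff_dim A + a) / 2)); [lra|lra|].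
by apply: (@dim_lt_null (a + 1)); [lra|apply: aA; lra|lra].
Qed.

Lemma null_finite s (l : seq 'rV[R]_d) : 0 < s -> null s [set` l].
Proof.
move=> s0 e e0; exists (fun i => [set x | (i < size l)%N /\ x = nth x l i]), (fun=> 0).
split => //.
- move=> x /= xl; exists (index x l) => //=.
  by rewrite index_mem nth_index.
- move=> i x y [il xE] [_ yE]; rewrite xE yE (set_nth_default y)// edistxx.
  by [].
- by move=> n; rewrite big1 ?ltW// => i _; rewrite powR0// gt_eqF.
Qed.

Lemma null_setU s A B : 0 < s -> null s A -> null s B -> null s (A `|` B).
Proof.
move=> s0 nA nB; apply: (@nullS _ _ (\bigcup_i (if i is 0%N then A else B))).
  by move=> x [Ax|Bx]; [exists 0%N|exists 1%N].
by apply: null_bigcup => // -[|i].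
Qed.

End Null.

(** * Capped flows on trees *)

Section Flow.
Context {R : realType} {B : finType}.
Variables (lam : R).
Hypotheses (lam0 : 0 < lam) (lam1 : lam < 1).
Implicit Types (P Q T : set (seq B)) (u v w : seq B) (n m k : nat).

Let pow0 w : 0 <= lam ^+ size w. Proof. by rewrite exprn_ge0// ltW. Qed.

(* Words grow at the head: the children of [w] are the words [b :: w]. *)
Fixpoint flow P n w : R := match n with
  | 0%N => if `[< P w >] then lam ^+ size w else 0
  | m.+1 => Num.min (lam ^+ size w) (\sum_b flow P m (b :: w)) end.

Lemma flowS P n w :
  flow P n.+1 w = Num.min (lam ^+ size w) (\sum_b flow P n (b :: w)).
Proof. by []. Qed.

Lemma ler_min_r (a x y : R) : x <= y -> Num.min a x <= Num.min a y.
Proof. by move=> xy; rewrite le_min !ge_min lexx xy orbT. Qed.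

Lemma flow_ge0 P n w : 0 <= flow P n w.
Proof.
elim: n w => [|n ih] w /=; first by case: ifP.
by rewrite le_min pow0 sumr_ge0.
Qed.

Lemma flow_le P n w : flow P n w <= lam ^+ size w.
Proof.
by case: n => [|n] /=; [case: ifP => // _; exact: pow0|rewrite ge_min lexx].
Qed.

Lemma flow_leaves P Q n w :
  (forall u, size u = n -> P (u ++ w) -> Q (u ++ w)) -> flow P n w <= flow Q n w.
Proof.
elim: n w => [|n ih] w /= PQ.
  case: ifPn => [/asboolP Pw|_]; last by case: ifP.
  by case: ifPn => // /asboolPn; have /(_ Pw) := PQ [::] erefl.
apply: ler_min_r; apply: ler_sum => b _; apply: ih => u un; rewrite -!cat_rcons.
by apply: PQ; rewrite size_rcons un.
Qed.

Lemma flow_subadd P Q n w : flow (P `|` Q) n w <= flow P n w + flow Q n w.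
Proof.
elim: n w => [|n ih] w /=.
  case: ifPn => [/asboolP[Pw|Qw]|_].
  - by rewrite asboolT//= lerDl; case: ifP.
  - by rewrite (asboolT Qw)/= lerDr; case: ifP.
  - by rewrite addr_ge0//; case: ifP.
set a := lam ^+ _; have a0 : 0 <= a := pow0 w.
set x := \sum_b _; set y := \sum_b _; set z := \sum_b _.
have xyz : x <= y + z by rewrite -big_split/= ler_sum.
have y0 : 0 <= y by apply: sumr_ge0 => b _; exact: flow_ge0.
have z0 : 0 <= z by apply: sumr_ge0 => b _; exact: flow_ge0.
rewrite /Num.min; do 3 case: ltP => ?; lra.
Qed.

Definition is_tree T := forall b w, T (b :: w) -> T w.

(** A word outside a tree has no child in it, so moving the leaves one level down can only lose
    flow. *)
Lemma flow_decr T n w : is_tree T -> flow T n.+1 w <= flow T n w.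
Proof.
move=> tT; elim: n w => [|n ih] w.
  rewrite /=; case: ifPn => [_|/asboolPn Tw]; first by rewrite ge_min lexx.
  rewrite ge_min big1 ?lexx ?orbT// => b _; rewrite asboolF//.
  by move=> /tT.
by rewrite flowS [leRHS]flowS ler_min_r// ler_sum.
Qed.

Lemma flow_pos P n w : 0 < flow P n w -> exists2 u, size u = n & P (u ++ w).
Proof.
elim: n w => [|n ih] w /=.
  by case: ifPn => [/asboolP Pw _|_]; [exists [::]|rewrite ltxx].
rewrite lt_min => /andP[_] /lt0r_neq0/eqP/psumr_neq0P[|b /ih[u un Pu]].
  by move=> b _; exact: flow_ge0.
by exists (rcons u b); [rewrite size_rcons un|rewrite cat_rcons].
Qed.

(** At most one child of [u] is an ancestor of [v], because suffixes of [v] of equal length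
    agree. *)
Lemma sum_one_child (f : B -> R) u v M : 0 <= M ->
  (forall b, 0 <= f b) -> (forall b, f b <= M) ->
  (forall b, ~~ suffix (b :: u) v -> f b = 0) -> \sum_b f b <= M.
Proof.
move=> M0 f0 fM fz; have [[b bv]|nb] := pselect (exists b, suffix (b :: u) v).
  rewrite (bigD1 b)//= big1 ?addr0// => b' b'b; apply: fz; apply/negP => b'v.

  move: bv b'v; rewrite !suffixE/= => /eqP -> /eqP[bb'].
  by rewrite bb' eqxx in b'b.
by rewrite big1// => b _; apply: fz; apply/negP => bv; apply: nb; exists b.
Qed.

Definition cone v := [set w | suffix v w].

(** From a word above [v] all flow into the cone passes through [v] and is capped there; a word
    below [v] has a smaller cap of its own, and a word incomparable with [v] carries nothing. *)
Lemma flow_cone v n u : flow (cone v) n u <= lam ^+ size v.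
Proof.
have zero : forall n u, ~~ suffix u v -> ~~ suffix v u -> flow (cone v) n u = 0.
  move=> {n u}; elim=> [|n ih] u uv vu /=; first by rewrite asboolF//; exact/negP.
  rewrite big1 ?min_r// => b _; apply: ih; apply/negP.
    by move=> buv; move/negP: uv; apply; apply: suffix_trans buv; exact: suffix_cons.
  move=> /suffixP[[|a x] /= E]; last first.
    by case: E => _ E; move/negP: vu; apply; apply/suffixP; exists x.
  by move/negP: uv; apply; rewrite -E suffix_cons.
elim: n u => [|n ih] u.
  apply: (@le_trans _ _ (if `[< cone v u >] then lam ^+ size u else 0)) => //.
  case: ifPn => [/asboolP /size_suffix vu|_]; last exact: pow0.
  by apply: ler_wiXn2l => //; exact: ltW.
rewrite flowS ge_min; have [vu|uv] := leqP (size v) (size u).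
  by rewrite ler_wiXn2l// ltW.
rewrite (@sum_one_child _ u v) ?orbT// => b; first exact: flow_ge0.
move=> buv; apply: zero => //; apply/negP => vbu.
have /suffixP[[|a x]] := vbu.
  by move=> /= E; move: buv; rewrite E suffix_refl.
by move=> /= [_ E]; move: uv; rewrite E size_cat ltnNge leq_addl.
Qed.

(** The flow is the least weight of a cut between [w] and the leaves, so the limit is the net
    content of the tree below [w]. *)
Definition flim T w : R := limn (fun n => flow T n w).

Lemma flow_cvg T w : is_tree T -> flow T n w @[n --> \oo] --> flim T w.
Proof.
move=> tT; apply: nonincreasing_is_cvgn.
  by apply/nonincreasing_seqP => n; exact: flow_decr.
by exists 0 => _ [n _ <-]; exact: flow_ge0.
Qed.

Lemma flim_ge T w c : is_tree T -> (forall n, c <= flow T n w) -> c <= flim T w.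
Proof.
move=> tT cT; apply: limr_ge; first by apply/cvg_ex; eexists; exact: flow_cvg.
exact: nearW.
Qed.

Lemma flim_ge0 T w : is_tree T -> 0 <= flim T w.
Proof. by move=> tT; apply: flim_ge => // n; exact: flow_ge0. Qed.

Lemma flow_nonincreasing T w n m : is_tree T -> (n <= m)%N ->
  flow T m w <= flow T n w.
Proof.
move=> tT; elim: m => [|m ih]; first by rewrite leqn0 => /eqP ->.
rewrite leq_eqVlt => /predU1P[<-//|/ih]; apply: le_trans.
exact: flow_decr.
Qed.

Lemma flim_le T n w : is_tree T -> flim T w <= flow T n w.
Proof.
move=> tT; apply: limr_le; first by apply/cvg_ex; eexists; exact: flow_cvg.
near=> m; apply: flow_nonincreasing => //; near: m; exact: nbhs_infty_ge.
Unshelve. all: by end_near. Qed.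

Lemma sum_flow_cvg T w : is_tree T ->
  (\sum_b flow T n (b :: w)) @[n --> \oo] --> \sum_b flim T (b :: w).
Proof.
move=> tT; apply: cvg_big => [|b _]; first exact: add_continuous.
exact: flow_cvg.
Qed.

Lemma flimE T w : is_tree T ->
  flim T w = Num.min (lam ^+ size w) (\sum_b flim T (b :: w)).
Proof.
move=> tT.
have h : Num.min (lam ^+ size w) (\sum_b flow T n (b :: w)) @[n --> \oo] -->
    Num.min (lam ^+ size w) (\sum_b flim T (b :: w)).
  (* Capping by [Num.min] does not increase distances, so the limit passes through the recursion. *)
  apply/cvgrPdist_lt => e e0; have /cvgrPdist_lt/(_ _ e0) := @sum_flow_cvg T w tT.
  apply: filterS => n; apply: le_lt_trans; set x := \sum_b _; set y := \sum_b _.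
  rewrite /Num.min; case: ltP => ?; case: ltP => ?; rewrite !ler_norml;
    have := ler_norm (x - y); have := ler_norm (y - x); rewrite (distrC y x);
    set z := `|x - y|; move=> *; by apply/andP; split; lra.
have h2 : flow T n.+1 w @[n --> \oo] --> flim T w.
  by have := @flow_cvg T w tT; rewrite -(cvg_shiftS (fun n => flow T n w)).
exact: (cvg_unique _ h2 h).
Qed.

Lemma flim_le_sum T w : is_tree T -> flim T w <= \sum_b flim T (b :: w).
Proof. by move=> tT; rewrite flimE// ge_min lexx orbT. Qed.

Definition good c T := is_tree T /\ forall n, c <= flow T n [::].

(** Zorn's lemma is applied to the removed sets. The flow at level [n] sees only the finitely many
    words of length [n], so for a chain a single set already removes all those that the union
    removes. *)
Lemma ex_minimal_good c T0 : good c T0 ->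
  exists T, [/\ T `<=` T0, good c T &
    forall T', T' `<=` T -> good c T' -> T' = T].
Proof.
move=> [tT0 cT0].
have [F FS Ftot|S [gS maxS]] := @Zorn_bigcup (seq B) (fun S => good c (T0 `\` S)).
  split=> [b w [Tbw nF]|n].
    split; first exact: tT0 Tbw.
    move=> [X FX Xw]; have [tX _] := FS _ FX.
    apply: (tX b w _).2 => //.
    by split => // Xbw; apply: nF; exists X.
  suff [X [XF gX]] : exists X, good c (T0 `\` X) /\
      forall u, size u = n -> (\bigcup_(Y in F) Y) u -> X u.
    have [_ /(_ n)] := XF; move/le_trans; apply; apply: flow_leaves => u un.
    by rewrite cats0 => -[Tu Xu]; split => // /(gX _ un).
  (* The search starts from the empty set, which may lie outside [F]; hence [F X] is claimed only
     when some word of the list is removed. *)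
  have fin (l : seq (seq B)) : exists X, good c (T0 `\` X) /\
      forall u, u \in l -> (\bigcup_(Y in F) Y) u -> X u /\ F X.
    elim: l => [|u l [X [gX lX]]].
      by exists set0; rewrite setD0; split.
    have [[Y FY Yu]|nu] := pselect ((\bigcup_(Y in F) Y) u); last first.
      exists X; split=> // v; rewrite inE => /predU1P[->//|]; exact: lX.
    have [FX|nFX] := pselect (F X); last first.
      exists Y; split; first exact: FS.
      by move=> v; rewrite inE => /predU1P[-> _//|vl Fv]; have [] := lX v vl Fv.
    have [XY|YX] := Ftot _ _ FX FY.
      exists Y; split; first exact: FS.
      move=> v; rewrite inE => /predU1P[-> _//|vl Fv]; have [Xv _] := lX v vl Fv.
      by split => //; exact: XY.
    exists X; split => // v; rewrite inE => /predU1P[-> _|vl Fv].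
      by split => //; exact: YX.
    exact: lX.
  have [X [gX lX]] := fin [seq val t | t : n.-tuple B].
  exists X; split => // u un Fu; refine (lX u _ Fu).1.
  by apply/fintype.imageP; exists (tcast un (in_tuple u)) => //=; rewrite val_tcast.
exists (T0 `\` S); split => //.
move=> T' T'T gT'; apply: contrapT => T'n; have := maxS (~` T'); apply; last first.
  rewrite setDE setCK (_ : T0 `&` T' = T')//.
  by apply/setIidPr => x /T'T[].
split; first by move=> x Sx /T'T[].
move=> CS; apply: T'n; apply/seteqP; split=> // x [_ nSx].
by apply: contrapT => T'x; exact/nSx/CS.
Qed.

(* If the cap at [w] were strictly below the sum over the children, the cone of
   a deep enough descendant of [w] could be removed without lowering the flow
   at the root. *)
Lemma minimal_flim_additive c T w : good c T ->
  (forall T', T' `<=` T -> good c T' -> T' = T) ->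
  flim T w = \sum_b flim T (b :: w).
Proof.
move=> [tT cT] minT; apply/eqP; rewrite eq_le flim_le_sum//= leNgt; apply/negP => Wlt.
have Ww : flim T w = lam ^+ size w.
  have := flimE w tT; rewrite /Num.min; case: ltP => // _ E.
  by move: Wlt; rewrite E ltxx.
set e := \sum_b flim T (b :: w) - lam ^+ size w.
have e0 : 0 < e by rewrite subr_gt0 -Ww.
(* Removing the cone of a word [m] levels below [w] costs each child of [w] at most [lam ^+ m]; over
   all children this is absorbed by the excess [e] over the cap. *)
have [m me] : exists m, #|B|%:R * lam ^+ m <= e.
  have := @cvg_geometric R #|B|%:R lam.
  rewrite ger0_norm ?(ltW lam0)// => /(_ lam1)/cvgrPdist_lt/(_ e e0)[m _ /(_ m)].
  rewrite /geometric/= leqnn sub0r normrN => /(_ isT) /(le_lt_trans (ler_norm _)).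
  by exists m; exact: ltW.
have /flow_pos[u um Tv] : 0 < flow T m w.
  by apply: lt_le_trans (flim_le _ _ tT); rewrite Ww exprn_gt0.
set v := u ++ w in Tv.
pose T' := T `\` cone v.
have tT' : is_tree T'.
  move=> b x [Tbx nbx]; split; first exact: tT Tbx.
  by move=> vx; apply: nbx; apply: suffix_trans vx _; exact: suffix_cons.
(* Induction from the level of [w] up to the root: at that level the other words lose no leaf and
   [w] still reaches its cap, and the recursion of [flow] carries the bound upwards. *)
have WT' k x : (size x + k)%N = size w -> forall n, flim T x <= flow T' n x.
  elim: k x => [|k ih] x; rewrite ?addn0 => xw n; last first.
    apply: le_trans (flow_decr _ _ tT'); rewrite flowS flimE// ler_min_r//.
    by apply: ler_sum => b _; apply: ih; rewrite -xw /= addSnnS.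
  have [->|xnw] := eqVneq x w; last first.
    apply: (le_trans (flim_le n x tT)); apply: flow_leaves => y _ Ty; split => //.
    rewrite /cone/= /v => vyx; move/negP: xnw; apply.
    have := catl_suffix vyx; rewrite -[w in suffix w]cat0s suffix_catl//.
    by move=> /andP[/eqP ->].
  apply: le_trans (flow_decr _ _ tT'); rewrite flowS Ww le_min lexx/=.
  have -> : lam ^+ size w = \sum_b flim T (b :: w) - e by rewrite /e; ring.
  rewrite lerBlDr; apply: (@le_trans _ _ (\sum_b (flow T' n (b :: w) + lam ^+ m))).
    apply: ler_sum => b _; apply: (le_trans (flim_le n _ tT)).
    apply: (@le_trans _ _ (flow (T' `|` cone v) n (b :: w))).
      apply: flow_leaves => y _ Ty.
      by have [cy|ncy] := pselect (cone v (y ++ b :: w)); [right|left].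
    apply: (le_trans (flow_subadd _ _ _ _)); rewrite lerD2l.
    apply: (le_trans (flow_cone _ _ _)); rewrite ler_wiXn2l//; try exact: ltW.
    by rewrite /v size_cat um leq_addr.
  by rewrite big_split/= lerD2l sumr_const -mulr_natl.
have gT' : good c T'.
  split => // n; apply: le_trans (WT' (size w) [::] erefl n).
  exact: flim_ge.
have T'E : T' = T by apply: minT => // x [].
by move: Tv; rewrite -T'E => -[_]; apply; exact: suffix_refl.
Qed.

End Flow.

(** * Covers read off from flows *)

Section FlowCover.
Context {R : realType} {B : finType}.
Variables (lam : R).
Hypotheses (lam0 : 0 < lam) (lam1 : lam < 1).
Implicit Types (P Q T : set (seq B)) (u v w : seq B) (n m k : nat).

(** The minimum in the recursion says whether to cut at [w] or below it; following these choices
    gives a cut whose weight is at most the flow. *)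
Lemma flow_cover P n w : exists F : seq (seq B),
  [/\ forall v, v \in F -> suffix w v,
      \sum_(v <- F) lam ^+ size v <= flow lam P n w &
      forall u, size u = n -> P (u ++ w) -> exists2 v, v \in F & suffix v (u ++ w)].
Proof.
elim: n w => [|n ih] w.
  have [Pw|nPw] := pselect (P w).
    exists [:: w]; split => [v||u]; first by rewrite inE => /eqP ->; exact: suffix_refl.
      by rewrite big_seq1/= asboolT.
    by move=> /size0nil -> _; exists w; rewrite ?inE//= suffix_refl.
  exists [::]; split => //; first by rewrite big_nil/= asboolF.
  by move=> u /size0nil ->.
have /choice[F FP] := fun b => ih (b :: w).
rewrite flowS; have [wS|Sw] := leP (lam ^+ size w) (\sum_b flow lam P n (b :: w)).
  exists [:: w]; split => [v||u _ _]; first by rewrite inE => /eqP ->; exact: suffix_refl.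
    by rewrite big_seq1.
  by exists w; rewrite ?inE// suffix_suffix.
exists (flatten [seq F b | b <- enum B]); split.
- move=> v /flatten_mapP[b _ vF]; have [/(_ v vF) bwv _ _] := FP b.
  by apply: suffix_trans bwv; exact: suffix_cons.
- rewrite big_flatten big_map big_enum/=; apply: ler_sum => b _.
  by have [] := FP b.
- move=> u; case: (lastP u) => // u' b; rewrite size_rcons => -[un].
  rewrite cat_rcons => Pu; have [_ _ /(_ u' un Pu)[v vF vu]] := FP b.
  exists v => //; apply/flatten_mapP; exists b => //.
  by rewrite mem_enum.
Qed.

(** Without caps on the first [k] levels a cut cannot use words there, so the cubes it yields are
    small. *)
Fixpoint deep_flow P k n w : R :=
  if k is k'.+1 then \sum_b deep_flow P k' n (b :: w) else flow lam P n w.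

Lemma deep_flow_cover P k n w : exists F : seq (seq B),
  [/\ forall v, v \in F -> (k + size w <= size v)%N,
      \sum_(v <- F) lam ^+ size v <= deep_flow P k n w &
      forall u, size u = (k + n)%N -> P (u ++ w) ->
        exists2 v, v \in F & suffix v (u ++ w)].
Proof.
elim: k w => [|k ih] w.
  have [F [F1 F2 F3]] := flow_cover P n w; exists F; split => // v /F1.
  by move=> /size_suffix.
have /choice[F FP] := fun b => ih (b :: w).
exists (flatten [seq F b | b <- enum B]); split.
- move=> v /flatten_mapP[b _ vF]; have [/(_ v vF) + _ _] := FP b.
  by rewrite /= addnS addSn.
- rewrite big_flatten big_map big_enum/=; apply: ler_sum => b _.
  by have [] := FP b.
- move=> u; case: (lastP u) => // u' b; rewrite size_rcons => -[un].
  rewrite cat_rcons => Pu; have [_ _ /(_ u' un Pu)[v vF vu]] := FP b.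
  exists v => //; apply/flatten_mapP; exists b => //.
  by rewrite mem_enum.
Qed.

(** Additivity of [flim] means that in the limit the caps on the first [k] levels may be dropped at
    no cost. *)
Lemma deep_flow_cvg T k w : is_tree T ->
  (forall v, flim lam T v = \sum_b flim lam T (b :: v)) ->
  deep_flow T k n w @[n --> \oo] --> flim lam T w.
Proof.
move=> tT addW; elim: k w => [|k ih] w /=; first exact: flow_cvg.
rewrite addW; apply: cvg_big => [|b _]; first exact: add_continuous.
exact: ih.
Qed.

(** This is what makes the net measure finite: arbitrarily fine covers weigh hardly more than the
    mass of the root. *)
Lemma flim_cover T k e : is_tree T -> 0 < e ->
  (forall v, flim lam T v = \sum_b flim lam T (b :: v)) ->
  exists N, exists F : seq (seq B),
  [/\ forall v, v \in F -> (k <= size v)%N,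
      \sum_(v <- F) lam ^+ size v <= flim lam T [::] + e &
      forall u, size u = N -> T u -> exists2 v, v \in F & suffix v u].
Proof.
move=> tT e0 addW.
have /cvgrPdist_lt/(_ _ e0)[n _ /(_ n (leqnn n))/= ne] :=
  @deep_flow_cvg T k [::] tT addW.
have [F [F1 F2 F3]] := deep_flow_cover T k n [::].
exists (k + n)%N, F; split => [v /F1||u un]; first by rewrite addn0.
  apply: (le_trans F2); rewrite -lerBlDl.
  by apply/ltW/(le_lt_trans (ler_norm _)); rewrite distrC.
by have := F3 u un; rewrite cats0.
Qed.

End FlowCover.

(** * Additive masses on words *)

Section LevelSum.
Context {R : realType} {B : finType}.
Variable mu : seq B -> R.
Hypothesis mu0 : forall w, 0 <= mu w.
Hypothesis mu_add : forall w, mu w = \sum_b mu (b :: w).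

Lemma sum_tupleS n (f : seq B -> R) :
  \sum_(t : n.+1.-tuple B) f t = \sum_(t : n.-tuple B) \sum_b f (b :: t).
Proof.
rewrite exchange_big pair_big/=.
rewrite (reindex (fun p : B * n.-tuple B => [tuple of p.1 :: p.2]))//=.
exists (fun t : n.+1.-tuple B => (thead t, [tuple of behead t])) => [[b t] _|t _] /=.
  by congr pair; exact: val_inj.
by rewrite [in RHS](tuple_eta t).
Qed.

Lemma sum_tuple_drop m n (Q : pred (seq B)) :
  \sum_(t : (m + n).-tuple B | Q (drop m t)) mu t = \sum_(t : n.-tuple B | Q t) mu t.
Proof.
elim: m => [|m ih]; first by under eq_bigl do rewrite drop0.
rewrite -ih big_mkcond/= (sum_tupleS _ (fun t => if Q (drop m.+1 t) then mu t else 0)).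
rewrite [RHS]big_mkcond/=; apply: eq_bigr => t _; rewrite [in RHS]mu_add.
by case: ifP => // _; rewrite big1.
Qed.

(** Everything is refined to the common level [N], where each word of positive mass is counted at
    least once; [drop (N - n i) t] is the ancestor of [t] of length [n i]. *)
Lemma mu_le_levels N (I : nat) (n : nat -> nat) (Q : nat -> pred (seq B)) :
  (forall i, (i < I)%N -> (n i <= N)%N) ->
  (forall t, size t = N -> 0 < mu t ->
    exists2 i, (i < I)%N & Q i (drop (N - n i) t)) ->
  mu [::] <= \sum_(i < I) \sum_(t : (n i).-tuple B | Q i t) mu t.
Proof.
move=> nN Qt.
have -> : mu [::] = \sum_(t : N.-tuple B) mu t.
  have := sum_tuple_drop N 0 xpredT; rewrite addn0 => ->.
  rewrite (big_pred1 [tuple])// => t; symmetry; apply/eqP; exact: tuple0.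
have E (i : 'I_I) : \sum_(t : (n i).-tuple B | Q i t) mu t =
    \sum_(t : N.-tuple B) (if Q i (drop (N - n i) t) then mu t else 0).
  rewrite -big_mkcond/= -(sum_tuple_drop (N - n i)).
  by move: (Q i) (n i) (nN i (ltn_ord i)) => Qi k kN; rewrite subnK.
under [in leRHS]eq_bigr do rewrite E.
rewrite exchange_big; apply: ler_sum => t _.
have [->|t0] := eqVneq (mu t) 0; first by apply: sumr_ge0 => i _; case: ifP.
have [||i iI Qi] := Qt t; first by rewrite size_tuple.
  by rewrite lt0r t0 mu0.
rewrite (bigD1 (Ordinal iI))//= Qi lerDl; apply: sumr_ge0 => j _.
by case: ifP.
Qed.

End LevelSum.

(** * Dyadic cubes *)

Section Cubes.
Context {R : realType} {d : nat}.
Variable M : R.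
Hypothesis M0 : 0 < M.

Definition letter := {ffun 'I_d -> bool}.
Implicit Types (w v : seq letter) (x y : 'rV[R]_d).

(** Words grow at the head, so the head letter holds the last binary digit of each coordinate. *)
Fixpoint cube_index w (i : 'I_d) : nat :=
  if w is b :: w' then (b i + (cube_index w' i).*2)%N else 0%N.

(** The affine map taking the interval from [-M] to [M] to the unit interval. *)
Definition unit_coord x (i : 'I_d) : R := (x 0 i + M) / (2 * M).

Definition cube w : set 'rV[R]_d := [set x | forall i,
  (cube_index w i)%:R <= unit_coord x i * 2 ^+ size w <= (cube_index w i).+1%:R].

Lemma cube_nil x : (forall i, `|x 0 i| <= M) -> cube [::] x.
Proof.
move=> xM i /=; rewrite expr0 mulr1 /unit_coord.
have := xM i; rewrite ler_norml => /andP[? ?].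
by rewrite divr_ge0 ?ler_pdivrMr ?mulr_gt0//=; lra.
Qed.


Lemma cube_index_consE b w i :
  (cube_index (b :: w) i)%:R = (b i)%:R + 2 * (cube_index w i)%:R :> R.
Proof. by rewrite /= natrD -mul2n natrM. Qed.

Lemma cubeE w x : cube w x <-> forall i,
  (cube_index w i)%:R <= unit_coord x i * 2 ^+ size w <= (cube_index w i)%:R + 1.
Proof. under eq_forall do rewrite natr1; by split=> h i; exact: h. Qed.

Lemma cube_consE b w x : cube (b :: w) x <-> forall i,
  (b i)%:R + 2 * (cube_index w i)%:R <= 2 * (unit_coord x i * 2 ^+ size w) <=
  (b i)%:R + 2 * (cube_index w i)%:R + 1.
Proof.
have E i : unit_coord x i * 2 ^+ size (b :: w) = 2 * (unit_coord x i * 2 ^+ size w).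
  by rewrite [size _]/= exprS mulrCA.
by split=> [/cubeE h i|h]; [|apply/cubeE => i]; have := h i; rewrite cube_index_consE E.
Qed.

Lemma cube_child w x : cube w x -> exists b, cube (b :: w) x.
Proof.
move=> /cubeE xw.
exists [ffun i => 2 * (cube_index w i)%:R + 1 <= 2 * (unit_coord x i * 2 ^+ size w)].
apply/cube_consE => i; rewrite ffunE; have /andP[h1 h2] := xw i.
have tE : true%:R = 1 :> R by [].
have fE : false%:R = 0 :> R by [].
by case: (leP (2 * _ + 1) _) => h3; rewrite ?tE ?fE; apply/andP; split; lra.
Qed.

Lemma cube_parent b w : cube (b :: w) `<=` cube w.
Proof.
move=> x /cube_consE xw; apply/cubeE => i; have /andP[] := xw i.
have : 0 <= (b i)%:R :> R by rewrite ler0n.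
have : (b i)%:R <= 1 :> R by rewrite lern1 leq_b1.
by move=> *; apply/andP; split; lra.
Qed.

Lemma cube_suffix v w : suffix v w -> cube w `<=` cube v.
Proof.
move=> /suffixP[u ->]; elim: u => [//|b u ih] x /cube_parent.
exact: ih.
Qed.

Lemma cube_level n x : (forall i, `|x 0 i| <= M) ->
  exists2 w, size w = n & cube w x.
Proof.
move=> xM; elim: n => [|n [w wn /cube_child[b bw]]].
  by exists [::] => //; exact: cube_nil.
by exists (b :: w); rewrite //= wn.
Qed.

(** An upper bound for the Euclidean diameter of the root cube, whose edges have length [2 * M]. *)
Definition side : R := d.+1%:R * (2 * M).

Lemma side_gt0 : 0 < side. Proof. by rewrite !mulr_gt0. Qed.

Lemma unit_coordB x y i : x 0 i - y 0 i = 2 * M * (unit_coord x i - unit_coord y i).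
Proof. by rewrite /unit_coord; field; exact: lt0r_neq0. Qed.

Lemma cube_diam w x y : cube w x -> cube w y -> edist x y <= side / 2 ^+ size w.
Proof.
move=> xw yw.
have p0 : 0 < 2 ^+ size w :> R by rewrite exprn_gt0.
apply: (@le_trans _ _ (d%:R * (2 * M / 2 ^+ size w))).
  apply: edist_le_coord; first by rewrite divr_ge0 ?mulr_ge0 ?(ltW M0)// ltW.
  move=> i; rewrite unit_coordB normrM gtr0_norm ?mulr_gt0//.
  rewrite ler_pM2l ?mulr_gt0// -div1r ler_pdivlMr// -[X in _ * X]gtr0_norm//.
  rewrite -normrM mulrBl; rewrite ler_norml.
  move/cubeE: xw => /(_ i); move/cubeE: yw => /(_ i).
  by move=> /andP[? ?] /andP[? ?]; apply/andP; split; lra.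
rewrite mulrA ler_pM2r ?invr_gt0// /side ler_pM2r ?mulr_gt0//.
by rewrite ler_nat.
Qed.

Lemma cube_closed w : closed (cube w).
Proof.
pose g (r : R) := (r + M) / (2 * M) * 2 ^+ size w.
have -> : cube w = \bigcap_(i in [set: 'I_d]) ((fun x : 'rV[R]_d => x 0 i) @^-1`
    (g @^-1` `[(cube_index w i)%:R, (cube_index w i).+1%:R])).
  by apply/seteqP; split=> x h i; [move=> _|]; [exact: h i|exact: h i Logic.I].
apply: closed_bigI => i _; apply: preimage_closed.
  by move=> x _; exact: coord_continuous.
apply: preimage_closed; last exact: interval_closed.
move=> x _; apply: cvgM; last exact: cvg_cst.
apply: cvgM; last exact: cvg_cst.
by apply: cvgD; [exact: cvg_id|exact: cvg_cst].
Qed.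

Lemma cube_index_inj v w : size v = size w ->
  (forall i, cube_index v i = cube_index w i) -> v = w.
Proof.
elim: v w => [[]//|b v ih] [//|c w] [vw] E.
have bc : b = c.
  by apply/ffunP => i; have := congr1 odd (E i); rewrite /= !oddD !odd_double !addbF !oddb.
congr cons => //; apply: ih => // i; have := E i; rewrite /= bc => /addnI/double_inj.
exact.
Qed.

(* The indices of two such cubes differ by at most 2 in each coordinate, so that
   a cube is determined by its indices modulo 3. *)
Lemma card_cubes_meeting (U : set 'rV[R]_d) n r :
  r <= 2 * M / 2 ^+ n -> (forall x y, U x -> U y -> edist x y <= r) ->
  (#|[pred t : n.-tuple letter | `[< cube t `&` U !=set0 >] ]| <= #|{ffun 'I_d -> 'I_3}|)%N.
Proof.
move=> rn dU.
set P := [pred t | _].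
have near (t t' : n.-tuple letter) i : P t -> P t' ->
    (cube_index t i <= cube_index t' i + 2)%N.
  move=> /asboolP[x [tx Ux]] /asboolP[y [ty Uy]].
  move/cubeE: tx => /(_ i); move/cubeE: ty => /(_ i).
  rewrite !size_tuple => /andP[? h2] /andP[h3 ?].
  rewrite -(ler_nat R) natrD; apply: (le_trans h3).
  have p0 : 0 < 2 ^+ n :> R by rewrite exprn_gt0.
  have := le_trans (coord_le_edist x y i) (le_trans (dU _ _ Ux Uy) rn).
  rewrite unit_coordB normrM (gtr0_norm (_ : 0 < 2 * M)) ?mulr_gt0//.
  rewrite ler_pM2l ?mulr_gt0// -div1r ler_pdivlMr// -[X in _ * X]gtr0_norm//.
  by rewrite -normrM mulrBl ler_norml => /andP[? ?]; lra.
pose f (t : n.-tuple letter) : {ffun 'I_d -> 'I_3} :=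
  [ffun i => inord (cube_index t i %% 3)].
rewrite -(card_in_image (f := f)); first exact: max_card.
move=> t t' tP tP' /ffunP ff; apply: val_inj; apply: cube_index_inj.
  by rewrite !size_tuple.
move=> i; have := congr1 val (ff i); rewrite !ffunE /= !inordK ?ltn_mod// => E.
have := near t t' i tP tP'; have := near t' t i tP' tP.
move: E; set a := cube_index t i; set b := cube_index t' i => E ? ?.
lia.
Qed.

End Cubes.

(** * Compact subsets of prescribed dimension *)

Section CompactSeq.
Context {R : numFieldType} {T : pseudoMetricType R}.

Lemma compact_cluster_seq (K : set T) (u : nat -> T) : compact K ->
  (forall n, K (u n)) -> exists2 x, K x &
  forall V, nbhs x V -> forall n, exists2 m, (n <= m)%N & V (u m).
Proof.
move=> cK Ku.
have FK : (u @ \oo) K by exists 0%N => // n _; exact: Ku.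
have [x [Kx xcl]] := cK (u @ \oo) _ FK.
exists x => // V xV n.
have [|y [[m nm <-] Vy]] := xcl [set u m | m in [set m | (n <= m)%N]] V _ xV.
  by exists n => // m nm; exists m.
by exists m.
Qed.

End CompactSeq.

Section Subset.
Context {R : realType} {d : nat}.
Implicit Types (A K L C : set 'rV[R]_d).
Variable M : R.
Hypothesis M0 : 0 < M.
Notation letter := (letter (d := d)).
Notation cube := (cube (d := d) M).
Notation side := (side (R := R) (d := d) M).


Definition ratio (t : R) : R := 2^-1 `^ t.

Lemma ratio_gt0 t : 0 < ratio t. Proof. exact: powR_gt0. Qed.

Lemma ratio_lt1 t : 0 < t -> ratio t < 1.
Proof.
move=> t0; rewrite /ratio [ltRHS](_ : _ = 1 `^ t); last by rewrite powR1.
by rewrite gt0_ltr_powR ?nnegrE ?invr_ge0// invf_lt1// ltr1n.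
Qed.

Lemma ratioX t n : ratio t ^+ n = (2 ^- n) `^ t.
Proof.
rewrite -powR_mulrn ?(ltW (ratio_gt0 t))// /ratio -powRrM mulrC powRrM.
by rewrite powR_mulrn ?invr_ge0// exprVn.
Qed.

Lemma ratioD s t : ratio (s + t) = ratio s * ratio t.
Proof. by rewrite /ratio powRD// invr_eq0 pnatr_eq0 implybT. Qed.

Lemma powR_side s n : (side / 2 ^+ n) `^ s = side `^ s * ratio s ^+ n.
Proof. by rewrite powRM ?(ltW (side_gt0 M0)) ?invr_ge0 ?exprn_ge0// ratioX. Qed.

Lemma content_le_cubes s e A (F : seq (seq letter)) : 0 < s ->
  (forall x, A x -> exists2 v, v \in F & cube v x) ->
  \sum_(v <- F) side `^ s * ratio s ^+ size v <= e -> content_le s e A.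
Proof.
move=> s0 AF Fe.
exists (fun i => if (i < size F)%N then cube (nth [::] F i) else set0).
exists (fun i => if (i < size F)%N then side / 2 ^+ size (nth [::] F i) else 0); split.
- move=> x /AF[v vF vx]; exists (index v F) => //=.
  by rewrite index_mem vF nth_index.
- by move=> i; case: ifP => // _; rewrite divr_ge0 ?exprn_ge0// ltW// side_gt0.
- move=> i x y; case: ifP => // _; exact: cube_diam.
move=> n; apply: le_trans Fe.
rewrite (big_nth [::]) big_mkord.
pose g i := side `^ s * ratio s ^+ size (nth [::] F i).
have g0 i : 0 <= g i by rewrite mulr_ge0 ?powR_ge0// exprn_ge0// ltW// ratio_gt0.
have E i : (if (i < size F)%N then side / 2 ^+ size (nth [::] F i) else 0) `^ s =
    if (i < size F)%N then g i else 0.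
  by case: ifP => _; [rewrite powR_side|rewrite powR0// gt_eqF].
under eq_bigr do rewrite E.
rewrite -(big_mkord xpredT (fun i => if (i < size F)%N then g i else 0)).
rewrite -(big_mkord xpredT g) -big_mkcond/=.
have [nF|Fn] := leqP n (size F).
  rewrite (big_cat_nat _ nF)//= [leLHS]big_nat_cond [X in _ <= X + _]big_nat_cond.
  rewrite [leLHS](eq_bigl (fun i => (0 <= i < n)%N && true)); last first.
    move=> i /=; rewrite andbT; case: ltnP => //= iN; exact: leq_trans nF.
  by rewrite lerDl sumr_ge0.
rewrite (big_cat_nat _ (ltnW Fn))//= [X in _ + X]big_nat_cond [X in _ + X]big1; last first.
  by move=> i /andP[/andP[Fi _] iF]; move: Fi; rewrite leqNgt iF.
rewrite addr0 big_nat_cond [leRHS]big_nat_cond.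
by rewrite (eq_bigl (fun i => (0 <= i < size F)%N && true))// => i /=; rewrite andbT andbb.
Qed.

(** The [2 ^ (d * n)] cubes of level [n] have a total weight proportional to [2 ^- n] at exponent
    [d.+1]. This supplies the exponent that [dim_lt_null] asks for. *)
Lemma bounded_null A : (forall x, A x -> forall i, `|x 0 i| <= M) ->
  null d.+1%:R A.
Proof.
move=> AM e e0.
have h : ratio 1 = 2^-1 by rewrite /ratio powRr1// invr_ge0.
have h' : ratio d.+1%:R = 2^-1 ^+ d.+1 by rewrite /ratio powR_mulrn// invr_ge0.
have : (fun n => side `^ d.+1%:R * 2^-1 ^+ n) @ \oo --> 0.
  apply: cvg_geometric; rewrite ger0_norm ?invr_ge0// invf_lt1// ltr1n//.
move=> /cvgrPdist_lt/(_ e e0)[n _ /(_ n (leqnn n))]; rewrite /= sub0r normrN.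
move=> /(le_lt_trans (ler_norm _))/ltW ne.
apply: (@content_le_cubes _ _ _ [seq val t | t : n.-tuple letter]) => //.
  move=> x /AM xM; have [w wn wx] := cube_level M0 n xM.
  exists w => //; apply/fintype.imageP; exists (tcast wn (in_tuple w)) => //=.
  by rewrite val_tcast.
rewrite big_map/= big_enum/=; under eq_bigr do rewrite size_tuple.
rewrite sumr_const card_tuple card_ffun card_bool card_ord h' -[_ *+ _]mulr_natl.
apply: le_trans ne; rewrite mulrCA ler_wpM2l ?powR_ge0//.
by rewrite !natrX -exprMn exprS mulrCA -exprMn divff// expr1n mulr1.
Qed.

End Subset.

Section SubsetOfDimension.
Context {R : realType} {d : nat}.
Implicit Types (A K L C : set 'rV[R]_d).
Variable M : R.
Hypothesis M0 : 0 < M.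
Notation letter := (letter (d := d)).
Notation cube := (cube (d := d) M).
Notation side := (side (R := R) (d := d) M).

Definition meeting_words L : set (seq letter) := [set w | L `&` cube w !=set0].

Lemma is_tree_meeting_words L : is_tree (meeting_words L).
Proof. by move=> b w [x [Lx /cube_parent wx]]; exists x. Qed.

(** A small flow at some level gives a cheap cut, and the cubes of the cut cover [L]. *)
Lemma not_null_flow t L : 0 < t -> (forall x, L x -> forall i, `|x 0 i| <= M) ->
  ~ null t L -> exists2 c, 0 < c & forall n, c <= flow (ratio t) (meeting_words L) n [::].
Proof.
move=> t0 LM nL; apply: contrapT => nc; apply: nL => e e0.
have s0 : 0 < side `^ t by rewrite powR_gt0// side_gt0.
have [n cn] : exists n, flow (ratio t) (meeting_words L) n [::] < e / side `^ t.
  apply: contrapT => nn; apply: nc; exists (e / side `^ t); first by rewrite divr_gt0.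
  by move=> n; rewrite leNgt; apply/negP => ?; apply: nn; exists n.
have [F [_ F2 F3]] := flow_cover (ratio t) (meeting_words L) n [::].
apply: (content_le_cubes M0 t0 (F := F)).
  move=> x Lx; have [w wn wx] := cube_level M0 n (LM _ Lx).
  have [|v vF] := F3 w wn; first by exists x; rewrite cats0.
  by rewrite cats0 => /cube_suffix/(_ _ wx) vx; exists v.
rewrite -mulr_sumr mulrC -ler_pdivlMr//; exact/(le_trans F2)/ltW.
Qed.

(** Take the least [n] with [2 ^- n <= r / M]. Minimality gives the reverse comparison up to a
    factor 2, except at [n = 0], where there is only one cube. *)
Lemma scale_of_radius t r : 0 < t -> 0 < r -> exists n,
  ratio t ^+ n <= (r / M) `^ t /\ (n = 0%N \/ r <= 2 * M / 2 ^+ n).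
Proof.
move=> t0 r0; have rM0 : 0 < r / M by rewrite divr_gt0.
suff [n [h1 h2]] : exists n, 2 ^- n <= r / M /\ (n = 0%N \/ r <= 2 * M / 2 ^+ n).
  exists n; split => //; rewrite ratioX.
  by apply: ge0_ler_powR; rewrite ?nnegrE ?invr_ge0 ?exprn_ge0// ltW.
have [Mr|rM] := leP M r.
  exists 0%N; split; last by left.
  by rewrite expr0 invr1 ler_pdivlMr// mul1r.
have : exists n, 2 ^- n <= r / M.
  have : (fun n => 1 * 2^-1 ^+ n) @ \oo --> (0 : R).
    by apply: cvg_geometric; rewrite ger0_norm ?invr_ge0// invf_lt1// ltr1n.
  move=> /cvgrPdist_lt/(_ _ rM0)[n _ /(_ n (leqnn n))]; rewrite /= sub0r normrN.
  rewrite mul1r exprVn => /(le_lt_trans (ler_norm _))/ltW ?; by exists n.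
move=> /ex_minnP[[|n] h1 h2].
  by move: h1; rewrite expr0 invr1 ler_pdivlMr// mul1r leNgt rM.
exists n.+1; split => //; right; rewrite leNgt; apply/negP => h3.
have /h2 : 2 ^- n <= r / M; last by rewrite ltnn.
rewrite ler_pdivlMr//; apply/ltW; apply: le_lt_trans h3.
rewrite (_ : 2 * M / 2 ^+ n.+1 = 2 ^- n * M)// exprS; field.
by rewrite expf_neq0.
Qed.

(** The additive content [W] of a minimal tree acts as a Frostman measure on [C]. Its fine covers
    make [C] null above [t], and the mass distribution principle prevents this at [t]. *)
Lemma exists_subset_of_measure t L : compact L -> 0 < t ->
  (forall x, L x -> forall i, `|x 0 i| <= M) -> ~ null t L ->
  exists C, [/\ C `<=` L, compact C, forall s, t < s -> null s C & ~ null t C].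
Proof.
move=> cL t0 LM nL.
have [c c0 cflow] := not_null_flow t0 LM nL.
pose lam := ratio t.
have lam0 : 0 < lam := ratio_gt0 t.
have lam1 : lam < 1 := ratio_lt1 t0.
have [T [TL gT minT]] := ex_minimal_good lam0 (conj (@is_tree_meeting_words L) cflow).
have [tT cT] := gT.
pose W := flim lam T.
have addW w : W w = \sum_b W (b :: w) := minimal_flim_additive lam0 lam1 w gT minT.
have W0 w : 0 <= W w by exact: flim_ge0.
have Wle w : W w <= lam ^+ size w.
  by apply: (le_trans (flim_le lam0 0 w tT)); exact: flow_le.
have WT w : 0 < W w -> T w.
  move=> w0; have := lt_le_trans w0 (flim_le lam0 0 w tT).
  by rewrite /=; case: ifPn => [/asboolP//|]; rewrite ltxx.
have Wpar b w : 0 < W (b :: w) -> 0 < W w.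
  move=> Wbw; rewrite addW; apply: lt_le_trans Wbw _.
  by rewrite (bigD1 b)//= lerDl sumr_ge0.
(* [C] will consist of the points of [L] lying at every level in a cube of positive mass; each level
   is finite, so [D n] is closed. *)
pose D n := \bigcup_(w in [set w | size w = n /\ 0 < W w]) cube w.
have Dcl n : closed (D n).
  apply: closed_bigcup => [|w _]; last exact: cube_closed.
  apply: (@sub_finite_set _ _ [set` [seq val x | x : n.-tuple letter]]) => //.
  move=> w [wn _] /=; apply/fintype.imageP; exists (tcast wn (in_tuple w)) => //.
  by rewrite /= val_tcast.
have Ddecr n x : D n.+1 x -> D n x.
  move=> [[|b w] [//= [wn] W1] wx]; exists w; last exact: cube_parent wx.
  by split => //; exact: Wpar W1.
have Dmono n m x : (n <= m)%N -> D m x -> D n x.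
  elim: m => [|m ih]; first by rewrite leqn0 => /eqP ->.
  by rewrite leq_eqVlt => /predU1P[<-//|nm /Ddecr]; exact: ih.
pose C := L `&` \bigcap_n D n.
have cC : compact C by apply: compact_closedI => //; apply: closed_bigI.
exists C; split => //; first by move=> x [].
  move=> s ts e e0; have s0 : 0 < s by apply: lt_trans ts.
  have st0 : 0 < s - t by rewrite subr_gt0.
  have S0 : 0 < side `^ s by rewrite powR_gt0// side_gt0.
  have W1 : 0 < W [::] + 1 by rewrite ltr_wpDl.
  (* For words of length at least [k], passing from exponent [t] to [s] gains the factor
     [ratio (s - t) ^+ k], while the weights at exponent [t] total at most [W [::] + 1]. *)
  have [k ke] : exists k, side `^ s * (W [::] + 1) * ratio (s - t) ^+ k <= e.
    have := @cvg_geometric R (side `^ s * (W [::] + 1)) (ratio (s - t)).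
    rewrite ger0_norm ?(ltW (ratio_gt0 _))// => /(_ (ratio_lt1 st0)).
    move=> /cvgrPdist_lt/(_ e e0)[m _ /(_ m (leqnn m))].
    rewrite /geometric/= sub0r normrN => /(le_lt_trans (ler_norm _)).
    by exists m; exact: ltW.
  have [N [F [F1 F2 F3]]] := flim_cover lam0 k tT ltr01 addW.
  apply: (content_le_cubes M0 s0 (F := F)).
    move=> x [_ /(_ N Logic.I)[w [wN /WT Tw] wx]].
    have [v vF vw] := F3 w wN Tw; exists v => //.
    exact: cube_suffix vw _ wx.
  apply: le_trans ke; rewrite -mulr_sumr -mulrA ler_wpM2l ?(ltW S0)//.
  rewrite mulrC.
  apply: (@le_trans _ _ (\sum_(v <- F) ratio (s - t) ^+ k * lam ^+ size v)).
    rewrite big_seq [leRHS]big_seq; apply: ler_sum => v /F1 kv.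
    rewrite -[s](subrK t) ratioD exprMn subrK ler_wpM2r ?exprn_ge0// ?(ltW lam0)//.
    by rewrite ler_wiXn2l ?(ltW (ratio_gt0 _)) ?(ltW (ratio_lt1 st0)).
  by rewrite -mulr_sumr ler_wpM2l ?exprn_ge0// ltW// ratio_gt0.
move=> nC.
pose q : R := #|{ffun 'I_d -> 'I_3}|%:R.
have q0 : 0 < q by rewrite ltr0n card_ffun !card_ord expn_gt0.
have cW : c <= W [::] by exact: flim_ge.
have Mt0 : 0 < M `^ t by rewrite powR_gt0.
(* A piece of radius [r i] carries mass at most [q] times the [t]-th power of [r i / M], so a cover
   of total at most [e + e] carries at most [c / 2], less than the mass of the root. *)
pose e := c * M `^ t / q / 4.
have e0 : 0 < e by rewrite !divr_gt0// mulr_gt0.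
have [U [r [CU oU r0 dU Sr]]] := content_le_open t0 e0 (nC _ e0).
(* Otherwise points of [D n] outside the first [n] pieces cluster at a point of [C], which lies in
   one of the open pieces. *)
have [N DN] : exists N, forall x, L x -> D N x -> exists2 i, (i < N)%N & U i x.
  apply: contrapT => nN.
  have /choice[u uP] : forall n, exists x, [/\ L x, D n x &
      forall i, (i < n)%N -> ~ U i x].
    move=> n; apply: contrapT => nx; apply: nN; exists n => x Lx Dx.
    by apply: contrapT => nU; apply: nx; exists x; split => // i iN Ux; apply: nU; exists i.
  have [|x Lx xcl] := @compact_cluster_seq R 'rV[R]_d L u cL.
    by move=> n; have [] := uP n.
  have Cx : C x.
    split => // n _; rewrite [X in X x]((closure_id _).1 (Dcl n)) => V xV.
    have [m nm Vm] := xcl V xV n; exists (u m); split => //.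
    by apply: (Dmono _ _ _ nm); have [] := uP m.
  have [i _ Ux] := CU x Cx.
  have [m im Um] := xcl (U i) (open_nbhs_nbhs (conj (oU i) Ux)) i.+1.
  by have [_ _ /(_ i im)] := uP m.
have /choice[n nP] := fun i => scale_of_radius t0 (r0 i).
pose N' := (N + \max_(i < N) n i)%N.
have count i : \sum_(w : (n i).-tuple letter | [pred w | `[< cube w `&` U i !=set0 >]] (val w)) W w
    <= q * (r i `^ t / M `^ t).
  have [h1 h2] := nP i.
  have -> : r i `^ t / M `^ t = (r i / M) `^ t.
    rewrite powRM ?invr_ge0 ?(ltW (r0 _)) ?(ltW M0)//; congr (_ * _).
    by rewrite -powR_inv1 ?powR_ge0// -powRrM mulrC powRrM powR_inv1// ltW.
  apply: (@le_trans _ _ (q * lam ^+ n i)); last by rewrite ler_pM2l.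
  apply: (@le_trans _ _ (\sum_(w : (n i).-tuple letter | `[< cube w `&` U i !=set0 >])
      lam ^+ n i)).
    by apply: ler_sum => w _; apply: (le_trans (Wle w)); rewrite size_tuple.
  rewrite sumr_const -mulr_natl ler_wpM2r ?exprn_ge0// ?(ltW lam0)// ler_nat.
  case: h2 => [ni|rn]; last exact: (card_cubes_meeting M0 rn (dU i)).
  apply: (leq_trans (max_card _)); rewrite card_tuple ni expn0.
  by rewrite -(ltr_nat R).
have W_le : W [::] <= \sum_(i < N) \sum_(w : (n i).-tuple letter |
    [pred w | `[< cube w `&` U i !=set0 >]] (val w)) W w.
  (* The common level is at least [N], so that cubes of positive mass lie in [D N], and at least
     every [n i]. *)
  apply: (@mu_le_levels R _ W W0 addW (N + \max_(i < N) n i)%N N n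
    (fun i => [pred w | `[< cube w `&` U i !=set0 >]])).
    by move=> i iN; rewrite (leq_trans _ (leq_addl _ _))// (leq_bigmax (Ordinal iN)).
  move=> w wN Ww; have [x [Lx wx]] := TL _ (WT _ Ww).
  have [|i iN Ux] := DN x Lx.
    by apply: (Dmono _ _ _ (leq_addr (\max_(i < N) n i) N)); exists w.
  exists i => //=; apply/asboolP; exists x; split => //.
  exact: cube_suffix (suffix_drop _ _) _ wx.
have := le_trans cW (le_trans W_le (ler_sum _ (fun i _ => count (val i)))).
rewrite -mulr_sumr -mulr_suml leNgt => /negP; apply.
apply: (@le_lt_trans _ _ (q * ((e + e) / M `^ t))).
  rewrite ler_pM2l// ler_pM2r ?invr_gt0//; exact: Sr.
rewrite (_ : q * _ = c / 2) ?gtr_pMr ?invf_lt1 ?ltr1n//.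
by rewrite /e; field; rewrite !lt0r_neq0.
Qed.

End SubsetOfDimension.

(** * Subsets of given dimension near a point of full local dimension *)

Section LocalDimension.
Context {R : realType} {d : nat}.
Implicit Types (A K L C : set 'rV[R]_d).

Lemma half_gt0 n : 0 < 2 ^- n :> R.
Proof. by rewrite invr_gt0 exprn_gt0. Qed.

Lemma half_pow_lt (e : R) : 0 < e -> exists N, forall n, (N <= n)%N -> 2 ^- n < e.
Proof.
move=> e0; have half : `|2^-1 : R| < 1.
  by rewrite ger0_norm ?invr_ge0// invf_lt1// ltr1n.
have [N _ NP] := (cvgrPdist_lt _ _).1 (cvg_geometric 1 half) _ e0.
exists N => n /NP; rewrite /geometric/= sub0r normrN mul1r exprVn.
exact/le_lt_trans/ler_norm.
Qed.

Lemma compact_bound K : compact K ->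
  exists2 M : R, 0 < M & forall x, K x -> forall i, `|x 0 i| <= M.
Proof.
move=> cK; have [M M0 MP] := compact_coord_bounded cK.
exists (M + 1); first by rewrite ltr_wpDl.
by move=> x Kx i; apply: (le_trans (MP x Kx i)); rewrite lerDl.
Qed.

Lemma compact_null K : compact K -> null d.+1%:R K.
Proof.
by move=> /compact_bound[M M0 KM]; apply: (bounded_null M0).
Qed.

Lemma dim_lt_null_compact K A s : compact K -> A `<=` K ->
  hausdorff_dim A < s -> null s A.
Proof.
move=> cK AK; apply: (@dim_lt_null _ _ d.+1%:R) => //.
exact: nullS AK (compact_null cK).
Qed.

Lemma le_hausdorff_dim K A : compact K -> A `<=` K ->
  hausdorff_dim A <= hausdorff_dim K.
Proof.
move=> cK AK; apply/ler_addgt0Pr => e e0.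
apply: null_dim_le; first by rewrite ltr_wpDl ?hausdorff_dim_ge0.
by apply: nullS AK _; apply: (dim_lt_null_compact cK) => //; rewrite ltrDl.
Qed.

Lemma dim_singleton (p : 'rV[R]_d) : hausdorff_dim [set p] = 0.
Proof.
apply: hausdorff_dim_eq => // s s0; last by rewrite ltNge ltW.
apply: (@nullS _ _ _ _ [set` [:: p]]); last exact: null_finite.
by move=> _ -> /=; rewrite inE.
Qed.

Lemma not_null_nonempty s A : 0 < s -> ~ null s A -> A !=set0.
Proof.
move=> s0 nA; apply: contrapT => A0; apply: nA.
apply: (@nullS _ _ _ _ [set` [::]]); last exact: null_finite.
by move=> x Ax; exfalso; apply: A0; exists x.
Qed.

(** A point and [K] itself serve at the two ends; strictly between them [K] is not [t]-null and
    [exists_subset_of_measure] applies. *)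
Lemma exists_compact_subset_dim K t : K !=set0 -> compact K ->
  0 <= t <= hausdorff_dim K ->
  exists C, [/\ C !=set0, compact C, C `<=` K & hausdorff_dim C = t].
Proof.
move=> [p Kp] cK; rewrite le_eqVlt => /andP[/predU1P[<- _|t0]].
  exists [set p]; split; [by exists p|exact: compact_set1|by move=> _ ->|].
  exact: dim_singleton.
rewrite le_eqVlt => /predU1P[->|tK]; first by exists K; split => //; exists p.
have [M M0 KM] := compact_bound cK.
have [C [CK cC Ct nC]] :=
  exists_subset_of_measure M0 cK t0 KM (lt_dim_not_null t0 tK).
exists C; split => //; first exact: not_null_nonempty nC.
apply: hausdorff_dim_eq => //; first exact: ltW.
by move=> s s0 st /(null_le s0 (ltW st)).
Qed.

Definition cball (p : 'rV[R]_d) (r : R) := [set x | edist p x <= r].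

Lemma closed_cball p r : closed (cball p r).
Proof.
move=> x clx; apply/ler_addgt0Pr => e e0.
have [y [py xy]] := clx _ (nbhs_edist x e0).
apply: (le_trans (edist_triangle y _ _)); rewrite lerD//.
by rewrite edist_sym ltW.
Qed.

Lemma not_null_cube M s K n : 0 < M -> 0 < s ->
  (forall x, K x -> forall i, `|x 0 i| <= M) -> ~ null s K ->
  exists2 w, size w = n & ~ null s (K `&` cube M w).
Proof.
move=> M0 s0 KM nK; elim: n => [|n [w wn nw]].
  exists [::] => // nK0; apply: nK; apply: nullS nK0 => x Kx; split => //.
  exact: cube_nil (KM x Kx).
apply: contrapT => nb; apply: nw.
pose l := enum (letter (d := d)).
apply: (@nullS _ _ _ _ (\bigcup_i
    (if (i < size l)%N then K `&` cube M (nth [ffun=> false] l i :: w) else set0))).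
  move=> x [Kx /cube_child[b bx]]; exists (index b l) => //.
  by rewrite index_mem mem_enum nth_index ?mem_enum.
apply: null_bigcup => // i; case: ifP => _.
  apply: contrapT => nn; apply: nb; exists (nth [ffun=> false] l i :: w) => //.
  by rewrite /= wn.
by apply: (@nullS _ _ _ _ [set` [::]]); last exact: null_finite.
Qed.

(** For exponents [s n] increasing to the dimension, choose a cube of level [n] in which [K] is not
    [s n]-null and a point in it. Any ball around a cluster point [p] contains such cubes with [n]
    arbitrarily large. *)
Lemma exists_full_local_dim K : K !=set0 -> compact K ->
  exists2 p, K p & forall r, 0 < r ->
    hausdorff_dim (K `&` cball p r) = hausdorff_dim K.
Proof.
move=> [p0 Kp0] cK; set D := hausdorff_dim K.
have leD p r : hausdorff_dim (K `&` cball p r) <= D.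
  by apply: le_hausdorff_dim => // x [].
have D0 : 0 <= D by exact: hausdorff_dim_ge0.
move: D0; rewrite le_eqVlt => /predU1P[D0|D0].
  exists p0 => // r r0; apply/eqP; rewrite eq_le leD/= -D0.
  exact: hausdorff_dim_ge0.
have [M M0 KM] := compact_bound cK.
pose s n := D - D * 2^-1 ^+ n.+1.
have sD n : s n < D by rewrite /s gtrBl mulr_gt0// exprn_gt0// invr_gt0.
have s0 n : 0 < s n.
  by rewrite /s subr_gt0 gtr_pMr// exprn_ilt1// ?invr_ge0// invf_lt1// ltr1n.
have /choice[w wP] : forall n, exists w, size w = n /\ ~ null (s n) (K `&` cube M w).
  move=> n; have [w wn nw] := not_null_cube n M0 (s0 n) KM (lt_dim_not_null (s0 n) (sD n)).
  by exists w.
have /choice[u uP] : forall n, exists x, (K `&` cube M (w n)) x.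
  by move=> n; have [_ /(not_null_nonempty (s0 n))] := wP n.
have [|p Kp pcl] := @compact_cluster_seq R 'rV[R]_d K u cK.
  by move=> n; have [] := uP n.
exists p => // r r0; apply/eqP; rewrite eq_le leD leNgt; apply/negP => dD.
pose t := (hausdorff_dim (K `&` cball p r) + D) / 2.
have dt : hausdorff_dim (K `&` cball p r) < t by rewrite /t; lra.
have tD : t < D by rewrite /t; lra.
have t0 : 0 < t by apply: le_lt_trans dt; exact: hausdorff_dim_ge0.
have nt : null t (K `&` cball p r).
  by apply: (dim_lt_null_compact cK) dt => x [].
have Dt : 0 < (D - t) / D by rewrite divr_gt0// subr_gt0.
have rS : 0 < r / 2 / side (d := d) M by rewrite !divr_gt0// side_gt0.
(* [N1] makes [s n] exceed [t]; [N2] makes the cube of level [n] smaller than [r / 2], so that it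
   fits into the ball around [p]. *)
have [N1 N1P] := half_pow_lt Dt; have [N2 N2P] := half_pow_lt rS.
have r20 : 0 < r / 2 by rewrite divr_gt0.
have [n Nn un] := pcl _ (nbhs_edist p r20) (N1 + N2)%N.
have [wn nw] := wP n.
apply: nw; apply: (@null_le _ _ t) => //.
  have := N1P n.+1 (leqW (leq_trans (leq_addr _ _) Nn)).
  by rewrite /s ltr_pdivlMr// mulrC -exprVn => ?; lra.
apply: nullS nt => x [Kx wx]; split => //.
apply: (le_trans (edist_triangle (u n) _ _)); rewrite [r]splitr lerD//; first exact: ltW.
have [_ uw] := uP n; apply: (le_trans (cube_diam M0 uw wx)).
rewrite wn mulrC -ler_pdivlMr ?side_gt0//; apply/ltW/N2P.
exact: leq_trans (leq_addl _ _) Nn.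
Qed.

End LocalDimension.

(** * The compact family over the Cantor space *)

Section Prefix.

Fixpoint prefix_word (y : nat -> bool) n : seq bool :=
  if n is m.+1 then y m :: prefix_word y m else [::].

Lemma size_prefix_word y n : size (prefix_word y n) = n.
Proof. by elim: n => //= n ->. Qed.

Lemma eq_prefix_word y y' n : (forall i, (i < n)%N -> y i = y' i) ->
  prefix_word y n = prefix_word y' n.
Proof.
elim: n => //= n ih yy; rewrite yy// ih// => i ni; apply: yy.
exact: ltn_trans ni _.
Qed.

End Prefix.

Section CompactPieces.
Context {R : realType} {d : nat}.
Implicit Types (A K L C : set 'rV[R]_d).

Lemma finite_net C e : compact C -> 0 < e -> exists l : seq 'rV[R]_d,
  [set` l] `<=` C /\ C `<=` closed_nbhd [set` l] e.
Proof.
move=> cC e0; move: (cC); rewrite compact_cover => cov.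
have [||D' D'C CD'] := cov _ C (fun c => (interior [set y | edist c y < e])).
- by move=> c _; exact: open_interior.
- by move=> x Cx; exists x => //; exact: nbhs_edist.
exists (finmap.enum_fset D'); split; first by move=> x /D'C; rewrite inE.
move=> x /CD'[c cD' /interior_subset cx]; exists c => //.
by rewrite edist_sym ltW.
Qed.

(** Away from [p] only finitely many of the pieces matter, and a finite union of compact sets is
    closed. *)
Lemma compact_shrinking_union K p (G : nat -> set 'rV[R]_d) : compact K ->
  K p -> (forall n, G n `<=` K) -> (forall n, compact (G n)) ->
  (forall n, G n `<=` cball p (2 ^- n)) -> compact ([set p] `|` \bigcup_n G n).
Proof.
move=> cK Kp GK cG Gp.
apply: (subclosed_compact _ cK); last first.
  by move=> x [->//|[n _ /GK]].
move=> x clx; apply: contrapT => nx.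
have xp : x <> p by move=> xp; apply: nx; left.
have ed : 0 < edist p x.
  rewrite lt0r edist_ge0 andbT; apply/eqP => e0; apply: xp; apply/esym.
  apply/rowP => i; apply/eqP; rewrite -subr_eq0 -normr_le0 -e0.
  exact: coord_le_edist.
have e20 : 0 < edist p x / 2 by rewrite divr_gt0.
have [N NP] := half_pow_lt e20.
pose H := \bigcup_(n in [set n | (n < N)%N]) G n.
have clH : closed H.
  apply: closed_bigcup => [|n _]; first exact: finite_II.
  by apply: compact_closed (cG n); exact: norm_hausdorff.
apply: nx; right; have : H x.
  rewrite [X in X x]((closure_id _).1 clH) => V xV.
  have [y [/= yG [yV xy]]] := clx _ (filterI xV (nbhs_edist x e20)).
  exists y; split => //; have px := edist_triangle y p x.
  have contra : edist p y < edist p x / 2 -> False.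
    by move=> py; move: px; rewrite (edist_sym y x); lra.
  case: yG => [yp|[n _ Gy]].
    by exfalso; apply: contra; rewrite yp edistxx.
  exists n => //=; rewrite ltnNge; apply/negP => Nn; apply: contra.
  by apply: le_lt_trans (NP n Nn); exact: Gp.
by move=> [n _ Gx]; exists n.
Qed.

End CompactPieces.

Section Family.
Context {R : realType} {d : nat}.
Variables (K : set 'rV[R]_d) (p : 'rV[R]_d) (B F : seq bool -> set 'rV[R]_d).
Hypotheses (cK : compact K) (Kp : K p).
Hypotheses (cB : forall w, compact (B w)) (cF : forall w, compact (F w)).
Hypotheses (BK : forall w, B w `<=` K `&` cball p (2 ^- size w))
           (FK : forall w, F w `<=` K `&` cball p (2 ^- size w)).

Implicit Types (y : nat -> bool) (w : seq bool) (n j : nat).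

Definition net w j : seq 'rV[R]_d := sval (cid (finite_net (@cF w) (half_gt0 j))).

Lemma net_sub w j : [set` net w j] `<=` F w.
Proof. by rewrite /net; case: cid => l /= []. Qed.

Lemma net_dense w j : F w `<=` closed_nbhd [set` net w j] (2 ^- j).
Proof. by rewrite /net; case: cid => l /= []. Qed.

(** The mesh [2 ^- j] vanishes as the next one recedes, so the nets converge to [F], which takes
    over when no one is left. The nets are finite and add nothing to the dimension. *)
Definition next_piece (y : nat -> bool) n : set 'rV[R]_d :=
  match pselect (exists j, (n <= j)%N && y j) with
  | left e => [set` net (prefix_word y n) (ex_minn e)]
  | right _ => F (prefix_word y n)
  end.

Lemma next_piece_sub y n : next_piece y n `<=` F (prefix_word y n).
Proof.
by rewrite /next_piece; case: pselect => [e|_]; [exact: net_sub|move=> x].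
Qed.

Lemma next_piece_zero y n : (forall j, (n <= j)%N -> ~~ y j) ->
  next_piece y n = F (prefix_word y n).
Proof.
move=> y0; rewrite /next_piece; case: pselect => [e|//]; exfalso.
by have [j /andP[/y0/negP]] := e.
Qed.

Lemma next_piece_finite y n j : (n <= j)%N -> y j ->
  exists l : seq 'rV[R]_d, next_piece y n = [set` l].
Proof.
move=> nj yj; rewrite /next_piece; case: pselect => [e|ne]; first by eexists.
by exfalso; apply: ne; exists j; rewrite nj.
Qed.

Lemma next_piece_one y n j : (n <= j)%N -> y j ->
  (forall i, (n <= i < j)%N -> ~~ y i) ->
  next_piece y n = [set` net (prefix_word y n) j].
Proof.
move=> nj yj ymin; rewrite /next_piece; case: pselect => [e|ne]; last first.
  by exfalso; apply: ne; exists j; rewrite nj.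
 case: ex_minnP => k /andP[nk yk] kmin.
suff -> : k = j by [].
apply/eqP; rewrite eqn_leq kmin ?nj//= leqNgt; apply/negP => kj.
by have := ymin k; rewrite nk kj yk => /(_ isT).
Qed.

Lemma compact_next_piece y n : compact (next_piece y n).
Proof.
rewrite /next_piece; case: pselect => [e|_]; last exact: cF.
by apply: finite_compact; exact: finite_seq.
Qed.

Definition level_piece y n := B (prefix_word y n) `|` next_piece y n.

Definition limit_set (y : nat -> bool) := [set p] `|` \bigcup_n level_piece y n.

Lemma level_piece_sub y n : level_piece y n `<=` K `&` cball p (2 ^- n).
Proof.
rewrite -{2}(size_prefix_word y n) => x [/BK//|/next_piece_sub/FK//].
Qed.

Lemma compact_limit_set y : compact (limit_set y).
Proof.
apply: (compact_shrinking_union cK Kp) => n.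
- by move=> x /level_piece_sub[].
- by apply: compactU; [exact: cB|exact: compact_next_piece].
- by move=> x /level_piece_sub[].
Qed.

Lemma limit_set_sub y : limit_set y `<=` K.
Proof. by move=> x [->//|[n _ /level_piece_sub[]]]. Qed.

(** Pieces beyond level [N] are within [2 ^- N] of [p]. At an earlier level, a next one of [y']
    before position [N] is shared with [y] and gives the same net; if it comes later, its net is
    [2 ^- N]-dense in [F]; if there is none, the piece is [F]. *)
Lemma limit_set_near y y' N : (forall i, (i < N)%N -> y i = y' i) ->
  limit_set y `<=` closed_nbhd (limit_set y') (2 ^- N).
Proof.
move=> yy' x; case=> [->|[n _ xn]].
  by exists p; [left|rewrite edistxx ltW].
have [nN|Nn] := leqP n N; last first.
  exists p; first by left.
  have [_] := level_piece_sub xn; rewrite /cball/= edist_sym => /le_trans; apply.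
  by rewrite lef_pV2 ?posrE ?exprn_gt0// ler_weXn2l ?ler1n// ltnW.
have E : prefix_word y n = prefix_word y' n.
  by apply: eq_prefix_word => i ni; apply: yy'; exact: leq_trans ni nN.
suff [x' [x'n xx']] : exists x', level_piece y' n x' /\ edist x x' <= 2 ^- N.
  by exists x' => //; right; exists n.
case: xn => [xB|xn]; first by exists x; split; [left; rewrite -E|rewrite edistxx ltW].
have xF : F (prefix_word y' n) x by rewrite -E; exact: next_piece_sub.
have [[j nj]|nj] := pselect (exists j, (n <= j)%N && y' j); last first.
  exists x; split; last by rewrite edistxx ltW.
  right; rewrite next_piece_zero// => j nj'; apply/negP => yj.
  by apply: nj; exists j; rewrite nj'.
have : exists j, (n <= j)%N && y' j by exists j.
move=> /ex_minnP[{nj}j /andP[nj yj] jmin].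
have y'min i : (n <= i < j)%N -> ~~ y' i.
  move=> /andP[ni ij]; apply/negP => yi; have := jmin i; rewrite ni yi => /(_ isT).
  by rewrite leqNgt ij.
have [jN|Nj] := ltnP j N.
  exists x; split; last by rewrite edistxx ltW.
  right; rewrite (next_piece_one nj yj y'min) -E -(@next_piece_one y n j)//.
    by rewrite yy'.
  move=> i /andP[ni ij]; rewrite yy' ?(ltn_trans ij jN)//.
  by apply: y'min; rewrite ni.
have [x' x'n xx'] := @net_dense (prefix_word y' n) j x xF.
exists x'; split; first by right; rewrite (next_piece_one nj yj y'min).
apply: (le_trans xx').
by rewrite lef_pV2 ?posrE ?exprn_gt0// ler_weXn2l ?ler1n.
Qed.

Lemma limit_set_hyperspace y :
  limit_set y \in [set C | [/\ C !=set0, compact C & C `<=` K]].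
Proof.
apply/mem_set; split; [by exists p; left|exact: compact_limit_set|].
exact: limit_set_sub.
Qed.

Definition limit_point (y : cantor_space) : hyperspace K :=
  exist _ (limit_set y) (limit_set_hyperspace y).

Lemma limit_point_dist y y' N : (forall i, (i < N)%N -> y i = y' i) ->
  hyperspace_dist (limit_point y) (limit_point y') <= 2 ^- N.
Proof.
move=> yy'; apply: ge_inf; first by exists 0 => e [].
split; [exact: ltW|exact: limit_set_near|apply: limit_set_near => i iN].
by rewrite yy'.
Qed.

Lemma cantor_cylinder (y : cantor_space) N :
  nbhs y [set y' : cantor_space | forall i, (i < N)%N -> y i = y' i].
Proof.
elim: N => [|N ih]; first by apply: filterS filterT.
have yN : nbhs y [set y' : cantor_space | y' N = y N].
  have := @proj_continuous nat (fun=> bool) N y [set b | b = y N].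
  by apply; exact: discrete_set1.
apply: filterS (filterI ih yN) => y' [/= h1 h2] i; rewrite ltnS leq_eqVlt.
by move=> /predU1P[->//|/h1].
Qed.

Lemma limit_point_continuous : continuous limit_point.
Proof.
move=> y; apply/cvg_ballP => e e0; have [N /(_ _ (leqnn N)) Ne] := half_pow_lt e0.
apply: filterS (cantor_cylinder y N) => y' yy'.
rewrite ballEmdist /=; apply: le_lt_trans Ne; exact: limit_point_dist.
Qed.

Lemma compact_range_limit_point : compact (range limit_point).
Proof.
apply: continuous_compact; last exact: cantor_space_compact.
exact/continuous_subspaceT/limit_point_continuous.
Qed.

End Family.

(** * A scheme in a Polish space *)

Section Scheme.
Context {R : realType} {X : metricType R}.
Hypothesis complX : complete_space X.
Variables (x0 : X) (xs : nat -> X).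
Hypothesis xs_dense : forall x e, 0 < e -> exists k, mdist (xs k) x < e.

(* A ball missing [S] is replaced by a point of [S], so that the scheme never
   becomes empty. *)
Definition shrink (S : set X) k m : set X :=
  let T := S `&` [set x | mdist (xs k) x <= 2 ^- m] in
  if pselect (T !=set0) then T else [set xget x0 S].

(** The number of zeros since the last one, [index true w'], selects the centre of the ball, and the
    number of ones so far, [count id w'], its radius. *)
Fixpoint scheme (w : seq bool) : set X := match w with
  | [::] => setT
  | false :: w' => scheme w'
  | true :: w' => shrink (scheme w') (index true w') (count id w')
  end.

Implicit Types (y : nat -> bool) (w : seq bool).

Lemma scheme_nonempty w : scheme w !=set0.
Proof.
elim: w => [|[] w ih] /=; [by exists x0| |by []].
by rewrite /shrink; case: pselect => [//|h] /=; exists (xget x0 (scheme w)).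
Qed.

Definition center w := xget x0 (scheme w).

Lemma scheme_center w : scheme w (center w).
Proof. by have [x wx] := scheme_nonempty w; exact: xgetI wx. Qed.

Lemma scheme_cons b w : scheme (b :: w) `<=` scheme w.
Proof.
case: b => //=; rewrite /shrink; case: pselect => h x /=; first by case.
by move=> ->; exact: scheme_center.
Qed.

Lemma scheme_prefix y n m : (n <= m)%N ->
  scheme (prefix_word y m) `<=` scheme (prefix_word y n).
Proof.
elim: m => [|m ih]; first by rewrite leqn0 => /eqP ->.
rewrite leq_eqVlt => /predU1P[<-//|/ih]; apply: subset_trans.
exact: scheme_cons.
Qed.

Lemma scheme_closed w : closed (scheme w).
Proof.
elim: w => [|[] w ih] /=; [exact: closedT| |by []].
rewrite /shrink; case: pselect => h /=.
  apply: closedI => // x clx /=; apply/ler_addgt0Pr => e e0.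
  have [z [/= xz]] := clx _ (nbhsx_ballx x e e0).
  rewrite ballEmdist /= metric_sym => zx.
  by rewrite (le_trans (metric_triangle _ z _))// lerD// ltW.
apply: accessible_closed_set1; apply: hausdorff_accessible.
exact: metric_hausdorff.
Qed.

Lemma scheme_diam w x x' : scheme (true :: w) x -> scheme (true :: w) x' ->
  mdist x x' <= 2 * 2 ^- count id w.
Proof.
rewrite /= /shrink; case: pselect => e /=; last first.
  move=> -> ->.
  by rewrite mdistxx mulr_ge0// invr_ge0 exprn_ge0.
move=> [_ h] [_ h'].
rewrite (le_trans (metric_triangle _ (xs (index true w)) _))// metric_sym.
by rewrite mulr_natl mulr2n lerD.
Qed.

Definition often y := forall n, exists2 j, (n <= j)%N & y j.

Lemma often_count y m : often y -> exists n, (m <= count id (prefix_word y n))%N.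
Proof.
move=> oy; elim: m => [|m [n mn]]; first by exists 0%N.
have [j nj yj] := oy n; exists j.+1; rewrite /= yj ltnS.
apply: (leq_trans mn); elim: j nj {yj} => [|j ih].
  by rewrite leqn0 => /eqP ->.
rewrite leq_eqVlt => /predU1P[<-//|/ih]/leq_trans; apply.
exact: leq_addl.
Qed.

Lemma often_small y e : often y -> 0 < e -> exists n, forall x x',
  scheme (prefix_word y n) x -> scheme (prefix_word y n) x' -> mdist x x' < e.
Proof.
move=> oy e0; have e20 : 0 < e / 2 by rewrite divr_gt0.
have [N NP] := half_pow_lt e20; have [n Nn] := often_count N oy.
have [j nj yj] := oy n; exists j.+1 => x x' /= xj x'j; move: xj x'j; rewrite yj.
move=> xj /(scheme_diam xj)/le_lt_trans; apply.
rewrite mulrC -ltr_pdivlMr//; apply: NP; apply: (leq_trans Nn).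
elim: j nj {yj xj} => [|j ih]; first by rewrite leqn0 => /eqP ->.
rewrite leq_eqVlt => /predU1P[<-//|/ih]/leq_trans; apply.
exact: leq_addl.
Qed.

(** Cantor's intersection argument: the centers form a Cauchy sequence by [often_small], and the
    closed sets of the scheme keep its limit. *)
Lemma often_point y : often y -> exists x, forall n, scheme (prefix_word y n) x.
Proof.
move=> oy; pose u n := center (prefix_word y n).
have uS n m : (n <= m)%N -> scheme (prefix_word y n) (u m).
  by move=> nm; apply: scheme_prefix nm _ _; exact: scheme_center.
have [|x ux] := complX (F := u @ \oo) _.
  apply/cauchy_ballP => e e0; have [n nP] := often_small oy e0.
  exists (u @` [set m | (n <= m)%N], u @` [set m | (n <= m)%N]) => /=.
    by split; exists n => // m nm; exists m.
  move=> [_ _] /= [[m nm <-] [k nk <-]].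
  by rewrite ballEmdist /=; apply: nP; exact: uS.
exists x => n; rewrite [X in X x]((closure_id _).1 (@scheme_closed _)) => V xV.
have [N _ NP] := ux _ xV; exists (u (maxn n N)); split.
  by apply: uS; exact: leq_maxl.
by apply: NP; rewrite /= leq_maxr.
Qed.

(** The greedy rule: a one is appended as soon as the ball on offer contains [x]. *)
Fixpoint code_word x n : seq bool := if n is m.+1 then
  let w := code_word x m in
  `[< mdist (xs (index true w)) x <= 2 ^- count id w >] :: w else [::].

Definition code x n : bool := head false (code_word x n.+1).

Lemma prefix_code x n : prefix_word (code x) n = code_word x n.
Proof. by elim: n => //= n ->. Qed.

Lemma scheme_code x n : scheme (prefix_word (code x) n) x.
Proof.
rewrite prefix_code; elim: n => //= n ih; case: asboolP => //= xn.
by rewrite /shrink; case: pselect => [//|nT]; exfalso; apply: nT; exists x.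
Qed.

(** After a last one, the zeros would run through the whole dense sequence at a fixed radius; some
    ball on offer would contain [x] and the greedy rule would append a one. *)
Lemma often_code x : often (code x).
Proof.
move=> n0; apply: contrapT => no.
have : exists n, `[< forall j, (n <= j)%N -> ~~ code x j >].
  exists n0; apply/asboolP => j nj; apply/negP => xj; apply: no; exists j => //.
(* With the least such [n] the word [w] is empty or headed by a one, so the selection of centres
   starts at index 0. *)
move=> /ex_minnP[n /asboolP n_zero nmin].
pose w := code_word x n.
have iw : index true w = 0%N.
  rewrite /w; case: n n_zero nmin {w} => [//|n] n_zero nmin.
  have : ~~ `[< forall j, (n <= j)%N -> ~~ code x j >].
    by apply/negP => /nmin; rewrite ltnn.
  move=> /asboolPn h; rewrite -prefix_code /=; case: (boolP (code x n)) => // xn.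
  exfalso; apply: h => j; rewrite leq_eqVlt => /predU1P[<-//|]; exact: n_zero.
have cE i : code_word x (n + i) = nseq i false ++ w.
  elim: i => [|i ih]; first by rewrite addn0.
  rewrite addnS -prefix_code /= prefix_code ih.
  by have /negbTE -> := n_zero (n + i)%N (leq_addr _ _).
have m0 : 0 < 2 ^- count id w :> R by rewrite invr_gt0 exprn_gt0.
have [k xk] := xs_dense x m0.
have /negP := n_zero (n + k)%N (leq_addr _ _); apply.
rewrite /code /=; apply/asboolP; rewrite cE.
have -> : index true (nseq k false ++ w) = k.
  by elim: k {xk} => //= k ->.
have -> : count id (nseq k false ++ w) = count id w by rewrite count_cat count_nseq.
exact: ltW.
Qed.

End Scheme.

(** * From analytic sets to compact families *)

Section AnalyticToCompact.
Context {R : realType} {d : nat}.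

Lemma separable_seq (X : metricType R) (x0 : X) : separable X ->
  exists xs : nat -> X, forall x e, 0 < e -> exists k, mdist (xs k) x < e.
Proof.
move=> [D cD dD]; have [g ginj] := elimT (countable_injP D) cD.
exists (fun k => xget x0 (D `&` [set z | g z = k])) => x e e0.
have [||z [/interior_subset xz Dz]] := dD (interior (ball x e)).
- by exists x; exact: nbhsx_ballx.
- exact: open_interior.
exists (g z); case: xgetP => [z' _ [Dz' gz]|/(_ z)[]//].
have -> : z' = z by apply: ginj; rewrite ?inE.
by move: xz; rewrite ballEmdist /= metric_sym.
Qed.

Lemma compact_family_of_analytic (K : set 'rV[R]_d) (A : set R) :
  K !=set0 -> compact K -> A `<=` [set x : R | 0 <= x <= hausdorff_dim K] ->
  analytic A -> exists CC : set (hyperspace K),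
    compact CC /\ [set hausdorff_dim (carrier C) | C in CC] = A.
Proof.
move=> K0 cK AD [X [f [[complX sepX] fc fA]]].
(* If [X] is empty then so is [A], and the empty family serves. *)
have [[x0 _]|X0] := pselect ([set: X] !=set0); last first.
  exists set0; split; first exact: compact0.
  rewrite image_set0 -fA; apply/seteqP; split=> [t []|t [x _ _]].
  by exfalso; apply: X0; exists x.
have [xs xsP] := separable_seq x0 sepX.
have [p Kp pD] := exists_full_local_dim K0 cK.
set dm := hausdorff_dim K in AD pD.
have f0 x : 0 <= f x <= dm by apply: AD; rewrite -fA; exists x.
pose S := scheme x0 xs; pose z := center x0 xs.
(* This infimum grows along prefixes and never exceeds the value of [f] at a point that stays in the
   sets, so the [B w] cannot push the dimension above that value. *)
pose low w := inf (f @` S w).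
have Sz w : S w (z w) := scheme_center x0 xs w.
have low_lb w : has_lbound (f @` S w).
  by exists 0 => _ [x _ <-]; have /andP[] := f0 x.
have low_le w x : S w x -> low w <= f x.
  by move=> wx; apply: ge_inf => //; exists x.
have le_low w c : (forall x, S w x -> c <= f x) -> c <= low w.
  move=> cf; apply: lb_le_inf; first by exists (f (z w)); exists (z w).
  by move=> _ [x wx <-]; exact: cf.
have sub w t : 0 <= t <= dm -> exists C, [/\ C !=set0, compact C,
    C `<=` K `&` cball p (2 ^- size w) & hausdorff_dim C = t].
  have r0 : 0 < 2 ^- size w :> R by rewrite invr_gt0 exprn_gt0.
  rewrite -(pD _ r0); apply: exists_compact_subset_dim.
    by exists p; split => //; rewrite /cball/= edistxx ltW.
  by apply: compact_closedI => //; exact: closed_cball.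
have /choice[B BP] : forall w, exists C, [/\ C !=set0, compact C,
    C `<=` K `&` cball p (2 ^- size w) & hausdorff_dim C = low w].
  move=> w; apply: sub; rewrite le_low => [|x _]; last by have /andP[] := f0 x.
  by rewrite (le_trans (low_le _ _ (Sz w)))//; have /andP[] := f0 (z w).
have /choice[F FP] : forall w, exists C, [/\ C !=set0, compact C,
    C `<=` K `&` cball p (2 ^- size w) & hausdorff_dim C = f (z w)].
  by move=> w; exact: sub.
have cB w : compact (B w) by have [] := BP w.
have cF w : compact (F w) by have [] := FP w.
have BK w : B w `<=` K `&` cball p (2 ^- size w) by have [] := BP w.
have FK w : F w `<=` K `&` cball p (2 ^- size w) by have [] := FP w.
have dB w : hausdorff_dim (B w) = low w by have [] := BP w.
have dF w : hausdorff_dim (F w) = f (z w) by have [] := FP w.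
pose G := limit_set p B cF.
have null_p s : 0 < s -> null s [set p].
  move=> s0; apply: (dim_lt_null_compact cK); first by move=> _ ->.
  by rewrite dim_singleton.
have null_B s w : low w < s -> null s (B w).
  by rewrite -dB; apply: (dim_lt_null_compact cK) => x /BK[].
have null_F s w : f (z w) < s -> null s (F w).
  by rewrite -dF; apply: (dim_lt_null_compact cK) => x /FK[].
have null_G s y : 0 < s -> (forall n, low (prefix_word y n) < s) ->
    (forall n, null s (next_piece cF y n)) -> null s (G y).
  move=> s0 ls ns; apply: null_setU => //; first exact: null_p.
  by apply: null_bigcup => // n; apply: null_setU => //; exact: null_B.
have dim_often y x : often y -> (forall n, S (prefix_word y n) x) ->
    hausdorff_dim (G y) = f x.
  move=> oy Sx; have /andP[fx0 _] := f0 x.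
  apply: hausdorff_dim_eq => // s.
    move=> fs; have s0 : 0 < s by exact: le_lt_trans fs.
    apply: null_G => // n; first exact: le_lt_trans (low_le _ _ (Sx n)) fs.
    have [j nj yj] := oy n; have [l ->] := next_piece_finite cF nj yj.
    exact: null_finite.
  move=> s0 sf nG.
  (* Near [x] the values of [f] stay above [f x - e], which exceeds [s]; so does the infimum over a
     small enough set of the scheme. *)
  pose e := (f x - s) / 2; have e0 : 0 < e by rewrite divr_gt0// subr_gt0.
  have /cvgrPdist_lt/(_ _ e0) := fc x; move=> /nbhs_ballP[r /= r0 rP].
  have [n nP] := often_small x0 xs oy r0.
  have nB : null s (B (prefix_word y n)).
    by apply: nullS nG => u Bu; right; exists n => //; left.
  apply: (@lt_dim_not_null _ _ s _ s0 _ nB); rewrite dB.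
  apply: (@lt_le_trans _ _ (f x - e)); first by rewrite /e; lra.
  apply: le_low => x' Sx'; have := rP x'; rewrite ballEmdist /=.
  by move=> /(_ (nP _ _ (Sx n) Sx')); rewrite ltr_norml => /andP[_]; lra.
have dim_zero y n0 : (forall j, (n0 <= j)%N -> ~~ y j) ->
    hausdorff_dim (G y) = f (z (prefix_word y n0)).
  (* Zeros do not change the set of the scheme, so beyond the last one the chosen points stay the
     same too. *)
  move=> y0; have S_eq n m : (n <= m)%N -> (forall j, (n <= j)%N -> ~~ y j) ->
      S (prefix_word y m) = S (prefix_word y n).
    move=> + yn0; elim: m => [|m ih]; first by rewrite leqn0 => /eqP ->.
    rewrite leq_eqVlt => /predU1P[<-//|nm]; rewrite -ih//.
    by rewrite /S /=; have /negbTE -> := yn0 m nm.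
  have z_eq n : (forall j, (n <= j)%N -> ~~ y j) ->
      z (prefix_word y n) = z (prefix_word y n0).
    by move=> yn0; rewrite /z /center; have [nn|/ltnW nn] := leqP n n0;
       [rewrite [scheme _ _ (prefix_word y n0)](S_eq n n0)|
        rewrite [scheme _ _ (prefix_word y n)](S_eq n0 n)].
  have /andP[fz0 _] := f0 (z (prefix_word y n0)).
  apply: hausdorff_dim_eq => // s.
    move=> fs; have s0 : 0 < s by exact: le_lt_trans fs.
    apply: null_G => // n.
      apply: le_lt_trans fs; apply: low_le; have [nn|/ltnW nn] := leqP n n0.
        exact: scheme_prefix nn _ (Sz _).
      by rewrite (S_eq n0 n).
    have [[j [nj yj]]|ny] := pselect (exists j, (n <= j)%N /\ y j).
      by have [l ->] := next_piece_finite cF nj yj; exact: null_finite.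
    have yn0 j : (n <= j)%N -> ~~ y j.
      by move=> nj; apply/negP => yj; apply: ny; exists j.
    by rewrite next_piece_zero//; apply: null_F; rewrite z_eq.
  move=> s0 sf nG.
  have nF : null s (F (prefix_word y n0)).
    apply: nullS nG => u Fu; right; exists n0 => //; right.
    by rewrite next_piece_zero.
  by apply: (@lt_dim_not_null _ _ s _ s0 _ nF); rewrite dF.
exists (range (limit_point cK Kp cB cF BK FK)); split.
  exact: compact_range_limit_point.
apply/seteqP; split.
  move=> _ [_ [y _ <-] <-]; rewrite -[hausdorff_dim _]/(hausdorff_dim (G y)) -fA.
  have [oy|noy] := pselect (often y).
    have [x Sx] := often_point complX x0 xs oy.
    by exists x => //; rewrite (dim_often _ _ oy Sx).
  have [n0 y0] : exists n0, forall j, (n0 <= j)%N -> ~~ y j.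
    apply: contrapT => nn; apply: noy => n; apply: contrapT => nj; apply: nn.
    by exists n => j nj'; apply/negP => yj; apply: nj; exists j.
  by exists (z (prefix_word y n0)) => //; rewrite (dim_zero _ _ y0).
rewrite -fA => _ [x _ <-].
exists (limit_point cK Kp cB cF BK FK (code xs x)); first by exists (code xs x).
rewrite -[LHS]/(hausdorff_dim (G (code xs x))).
apply: dim_often; first exact: often_code.
exact: scheme_code.
Qed.

End AnalyticToCompact.

(** * Closed subsets of the Baire space *)

Section BaireDistance.
Context {R : realType}.
Implicit Types a b c : nat -> nat.

Lemma neq_index a b : a <> b -> exists n, a n != b n.
Proof.
move=> ab; apply: contrapT => n; apply: ab; apply/funext => i.
by apply/eqP; apply: contrapT => /negP ?; apply: n; exists i.
Qed.

Definition baire_dist a b : R := match pselect (a = b) with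
  | left _ => 0
  | right ab => 2 ^- ex_minn (neq_index ab)
  end.

Lemma le_half_pow n m : (2 ^- m <= 2 ^- n :> R) = (n <= m)%N.
Proof.
by rewrite lef_pV2 ?posrE ?exprn_gt0// ler_eXn2l// ltr1n.
Qed.

Lemma baire_dist_le a b n :
  baire_dist a b <= 2 ^- n <-> forall i, (i < n)%N -> a i = b i.
Proof.
rewrite /baire_dist; case: pselect => [->|ab].
  by split=> // _; rewrite invr_ge0 exprn_ge0.
case: ex_minnP => m abm mmin; rewrite le_half_pow; split.
  move=> nm i ni; apply/eqP; apply: contrapT => /negP /mmin.
  by rewrite leqNgt (leq_trans ni).
move=> h; rewrite leqNgt; apply/negP => mn; move: abm.
by rewrite h// eqxx.
Qed.

Lemma baire_dist_ge a b n : a n != b n -> 2 ^- n <= baire_dist a b.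
Proof.
rewrite /baire_dist; case: pselect => [->|ab]; first by rewrite eqxx.
by case: ex_minnP => m _ mmin /mmin; rewrite le_half_pow.
Qed.

Lemma baire_distxx a : baire_dist a a = 0.
Proof. by rewrite /baire_dist; case: pselect. Qed.

Lemma baire_dist_eq0 a b : baire_dist a b = 0 -> a = b.
Proof.
rewrite /baire_dist; case: pselect => // ab /eqP.
by rewrite invr_eq0 expf_eq0 pnatr_eq0 andbF.
Qed.

Lemma baire_dist_sym a b : baire_dist a b = baire_dist b a.
Proof.
have le x y : baire_dist x y <= baire_dist y x.
  rewrite {2}/baire_dist; case: pselect => [->|yx]; first by rewrite baire_distxx.
  case: ex_minnP => m _ mmin; apply/baire_dist_le => i im.
  apply/eqP; apply: contrapT => /negP; rewrite eq_sym => /mmin.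
  by rewrite leqNgt im.
by apply/eqP; rewrite eq_le !le.
Qed.

Lemma baire_dist_ge0 a b : 0 <= baire_dist a b.
Proof.
by rewrite /baire_dist; case: pselect.
Qed.

Lemma baire_dist_triangle b a c : baire_dist a c <= baire_dist a b + baire_dist b c.
Proof.
rewrite {1}/baire_dist; case: pselect => [_|ac].
  by rewrite addr_ge0// baire_dist_ge0.
case: ex_minnP => m acm _; have [abm|abm] := eqVneq (a m) (b m).
  rewrite abm in acm; apply: le_trans (baire_dist_ge acm) _.
  by rewrite lerDr baire_dist_ge0.
by apply: le_trans (baire_dist_ge abm) _; rewrite lerDl baire_dist_ge0.
Qed.

End BaireDistance.

(** [R] is an argument so that a metric with values in [R] can be attached to the type. *)
Definition baire_subspace (R : realType) (Z : set (nat -> nat)) : Type := set_type Z.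

Section BaireSubspace.
Context {R : realType} {Z : set (nat -> nat)}.
Implicit Types x y z : baire_subspace R Z.

HB.instance Definition _ := Choice.on (baire_subspace R Z).

Definition sequence_of x : nat -> nat := val x.

Lemma sequence_ofP x : Z (sequence_of x).
Proof. exact: set_mem (valP x). Qed.

Definition subspace_dist x y : R := baire_dist (sequence_of x) (sequence_of y).

Lemma subspace_distxx x : subspace_dist x x = 0. Proof. exact: baire_distxx. Qed.

Lemma subspace_dist_eq0 x y : subspace_dist x y = 0 -> x = y.
Proof. by move/baire_dist_eq0/val_inj. Qed.

Lemma subspace_dist_sym x y : subspace_dist x y = subspace_dist y x.
Proof. exact: baire_dist_sym. Qed.

Lemma subspace_dist_triangle y x z :
  subspace_dist x z <= subspace_dist x y + subspace_dist y z.
Proof. exact: baire_dist_triangle. Qed.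

HB.instance Definition _ := @isMetric.Build R (baire_subspace R Z) subspace_dist
  subspace_distxx subspace_dist_eq0 subspace_dist_sym subspace_dist_triangle.

Lemma baire_ball x n y : (forall i, (i < n)%N -> sequence_of x i = sequence_of y i) ->
  forall e : R, 2 ^- n < e -> ball x e y.
Proof.
move=> xy e ne; rewrite ballEmdist /=; apply: le_lt_trans ne.
exact/baire_dist_le.
Qed.

Lemma ball_baire x n y : ball x (2 ^- n) y ->
  forall i, (i < n)%N -> sequence_of x i = sequence_of y i.
Proof. by rewrite ballEmdist /= => /ltW; exact: (baire_dist_le _ _ _).1. Qed.

Hypothesis Zclosed : forall a, (forall n, exists2 b, Z b &
  forall i, (i < n)%N -> b i = a i) -> Z a.

(** A Cauchy filter has for each [n] a member on which the first [n] terms are constant; these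
    constants form the limit, which closedness keeps in [Z]. *)
Lemma baire_subspace_complete : complete_space (baire_subspace R Z).
Proof.
move=> F PF /cauchy_ballP cF.
have /choice[A AP] : forall n, exists A : set (baire_subspace R Z), F A /\
    forall x y, A x -> A y -> forall i, (i < n)%N -> sequence_of x i = sequence_of y i.
  move=> n; have [[A B] /= [FA FB] AB] := cF _ (half_gt0 n).
  exists (A `&` B); split; first exact: filterI.
  by move=> x y [Ax _] [_ By]; apply: ball_baire; exact: (AB (x, y)).
have /choice[u uA] : forall n, exists x, A n x.
  by move=> n; have [/filter_ex[x Ax] _] := AP n; exists x.
pose a n := sequence_of (u n.+1) n.
have Aa n x : A n x -> forall i, (i < n)%N -> sequence_of x i = a i.
  move=> Ax i ni; have [FA AE] := AP n; have [FA' AE'] := AP i.+1.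
  have [w [Aw Aw']] := filter_ex (filterI FA FA').
  by rewrite (AE _ _ Ax Aw _ ni) /a (AE' _ _ (uA i.+1) Aw' _ (ltnSn i)).
have Za : Z a.
  by apply: Zclosed => n; exists (sequence_of (u n)); [exact: sequence_ofP|exact: Aa].
exists (exist _ a (mem_set Za) : baire_subspace R Z).
apply/cvg_ballP => e e0; have [n /(_ _ (leqnn n)) ne] := half_pow_lt e0.
apply: filterS (AP n).1 => x Ax; apply: (@baire_ball _ n) => // i ni.
by rewrite (Aa _ _ Ax).
Qed.

(** One element is chosen for each finite word that begins some element of [Z]. *)
Lemma baire_subspace_separable : separable (baire_subspace R Z).
Proof.
have [[z0 _]|Z0] := pselect ([set: baire_subspace R Z] !=set0); last first.
  exists set0; first exact: countable0.
  by move=> U [x _]; exfalso; apply: Z0; exists x.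
pose h (l : seq nat) := xget z0 [set z | mkseq (sequence_of z) (size l) = l].
exists (range h).
  exact: sub_countable (card_image_le h setT) (countableP _).
move=> U [x Ux] oU.
have /nbhs_ballP[e /= e0 eU] : nbhs x U by exact: open_nbhs_nbhs.
have [n /(_ _ (leqnn n)) ne] := half_pow_lt e0.
pose l := mkseq (sequence_of x) n.
exists (h l); split; last by exists l.
apply: eU; apply: (@baire_ball _ n) => // i ni; rewrite /h.
case: xgetP => [z _ /=|/(_ x) nx]; last first.
  by exfalso; apply: nx; rewrite /= /l size_mkseq.
rewrite /l size_mkseq => zl; have := congr1 (fun s => nth 0%N s i) zl.
by rewrite !nth_mkseq.
Qed.

Lemma analytic_image_baire (f : (nat -> nat) -> R) :
  (forall a e, Z a -> 0 < e -> exists n, forall b, Z b ->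
    (forall i, (i < n)%N -> a i = b i) -> `|f a - f b| < e) ->
  analytic (f @` Z).
Proof.
move=> fc; exists (baire_subspace R Z), (f \o sequence_of); split.
- by split; [exact: baire_subspace_complete|exact: baire_subspace_separable].
- move=> x U /nbhs_ballP[e /= e0 eU].
  have [n nP] := fc _ _ (sequence_ofP x) e0.
  apply/nbhs_ballP; exists (2 ^- n) => /=; first by rewrite invr_gt0 exprn_gt0.
  by move=> y /ball_baire xy; apply: eU; apply: nP => //; exact: sequence_ofP.
- apply/seteqP; split=> [_ [x _ <-]|_ [a Za <-]].
    by exists (sequence_of x) => //; exact: sequence_ofP.
  by exists (exist _ a (mem_set Za)).
Qed.

End BaireSubspace.

(** * Coding the graph of a function on a compact metric space *)

Section CodedImage.
Context {R : realType} {M : metricType R}.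
Implicit Types (S : set M).

(** Near-covering compactness is used along the filter of lists ordered by inclusion: any list
    containing [x] works near [x], so a large enough one works everywhere. *)
Lemma compact_net S e : compact S -> 0 < e ->
  exists l : seq M, forall x, S x -> exists2 a, a \in l & ball a e x.
Proof.
move=> /compact_near_coveringP cS e0.
pose Fl := filter_from setT (fun l0 : seq M => [set l : seq M | {subset l0 <= l}]).
have FF : Filter Fl.
  apply: filter_from_filter; first by exists [::].
  move=> l1 l2 _ _; exists (l1 ++ l2) => // l ll; split=> x xl; apply: ll.
    by rewrite mem_cat xl.
  by rewrite mem_cat xl orbT.
have [|l _ lP] := cS _ Fl (fun l x => exists2 a, a \in l & ball a e x) FF; last first.
  by exists l => x; exact: lP.
move=> x Sx; exists (ball x e, [set l : seq M | {subset [:: x] <= l}]) => /=.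
  by split; [exact: nbhsx_ballx|exists [:: x]].
move=> [y l] /= [xy xl]; exists x => //; apply: xl.
by rewrite inE.
Qed.

Variables (S : set M) (g : M -> R) (bnd : R) (O : rat -> nat -> set M).
Hypotheses (cS : compact S) (gS : forall x, S x -> 0 <= g x <= bnd).
Hypothesis oO : forall q j, open (O q j).
(** Together with [g_ge], this places the intersection of the [O q j] on [S] between the sets where
    [g < ratr q] and where [g <= ratr q]. *)
Hypothesis g_le : forall q x, S x -> (forall j, O q j x) -> g x <= ratr q.
Hypothesis g_ge : forall q x, S x -> ~ (forall j, O q j x) -> ratr q <= g x.

(** Four kinds of entries: an approximation of the point, one of the value, a radius witnessing
    membership in [O q j], and an index [j] witnessing non-membership. *)
Let key := ((nat + nat) + (rat * nat + rat))%type.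

Definition code_at (a : nat -> nat) (k : key) : nat := a (pickle k).

Variable c : nat -> nat -> M.
Hypothesis c_net : forall n x, S x -> exists i, mdist (c n i) x <= 2 ^- n.

(* Every clause is closed in [(C, x)] once the entry of [a] is fixed. *)
Definition codes (C : M) (x : R) (a : nat -> nat) := [/\
  S C /\ 0 <= x <= bnd,
  forall n, mdist (c n (code_at a (inl (inl n)))) C <= 2 ^- n,
  forall n, `|(code_at a (inl (inr n)))%:R * 2 ^- n - x| <= 2 ^- n,
  forall q j, ratr q <= x \/
    ball C (2 ^- code_at a (inr (inl (q, j)))) `<=` O q j &
  forall q, x <= ratr q \/ ~ O q (code_at a (inr (inr q))) C].

(** A rational strictly between the two values contradicts the last clause if [g C < x] and the one
    before it if [x < g C]. *)
Lemma codes_value C x a : codes C x a -> x = g C.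
Proof.
move=> [[SC _] _ _ h1 h2]; apply/eqP; rewrite eq_le; apply/andP; split.
  rewrite leNgt; apply/negP => gx.
  have [q] := rat_in_itvoo gx; rewrite in_itv /= => /andP[gq qx].
  have [|nO] := h2 q; first by rewrite leNgt qx.
  by move: gq; rewrite ltNge g_ge// => /(_ (code_at a (inr (inr q)))).
rewrite leNgt; apply/negP => xg.
have [q] := rat_in_itvoo xg; rewrite in_itv /= => /andP[xq qg].
move: qg; rewrite ltNge g_le// => j.
have [|qO] := h1 q j; first by rewrite leNgt xq.
by apply: qO; apply: ballxx; exact: half_gt0.
Qed.

Lemma ex_codes C : S C -> exists a, codes C (g C) a.
Proof.
move=> SC; have /andP[g0 gb] := gS SC.
suff /choice[a aP] : forall k : key, exists m : nat, match k with
    | inl (inl n) => mdist (c n m) C <= 2 ^- n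
    | inl (inr n) => `|m%:R * 2 ^- n - g C| <= 2 ^- n
    | inr (inl (q, j)) => ratr q <= g C \/ ball C (2 ^- m) `<=` O q j
    | inr (inr q) => g C <= ratr q \/ ~ O q m C
    end.
  exists (fun n => oapp a 0%N (pickle_inv n)); split.
  - by rewrite g0.
  - by move=> n; rewrite /code_at pickleK_inv; exact: aP (inl (inl n)).
  - by move=> n; rewrite /code_at pickleK_inv; exact: aP (inl (inr n)).
  - by move=> q j; rewrite /code_at pickleK_inv; exact: aP (inr (inl (q, j))).
  - by move=> q; rewrite /code_at pickleK_inv; exact: aP (inr (inr q)).
move=> [[n|n]|[[q j]|q]].
- exact: c_net.
- exists (Num.truncn (g C * 2 ^+ n)).
  have p0 : 0 < 2 ^+ n :> R by rewrite exprn_gt0.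
  have /andP[] := truncn_itv (mulr_ge0 g0 (ltW p0)); rewrite -natr1.
  set m := (Num.truncn _)%:R => h1 h2.
  rewrite -[g C](mulfK (lt0r_neq0 p0)) -mulrBl normrM (gtr0_norm (half_gt0 n)).
  by rewrite ler_piMl ?(ltW (half_gt0 n))// ler_norml; apply/andP; split; lra.
- have [|gq] := leP (ratr q) (g C); first by exists 0%N; left.
  have OC : O q j C.
    apply: contrapT => nO; have := g_ge SC (fun h => nO (h j)).
    by rewrite leNgt gq.
  have /nbhs_ballP[e /= e0 eO] : nbhs C (O q j) by exact: open_nbhs_nbhs.
  have [n /(_ _ (leqnn n)) ne] := half_pow_lt e0.
  by exists n; right => y Cy; apply: eO; apply: le_ball Cy; exact: ltW.
- have [|qg] := leP (g C) (ratr q); first by exists 0%N; left.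
  have [j nO] : exists j, ~ O q j C.
    by apply/existsNP => h; move: qg; rewrite ltNge g_le.
  by exists j; right.
Qed.

Definition code_set := [set a | exists C x, codes C x a].

Definition coded_value (a : nat -> nat) : R := xget 0 [set x | exists C, codes C x a].

Lemma coded_valueP a : code_set a -> exists C, codes C (coded_value a) a.
Proof.
move=> [C [x Cx]]; rewrite /coded_value; case: xgetP => [y _ //|/(_ x) h].
by exfalso; apply: h; exists C.
Qed.

(** The pairs behind the approximating codes cluster in the compact set of [S] times the interval
    from 0 to [bnd]. Each clause instance involves a single entry of [a], which the approximants
    eventually share, and so passes to the cluster point. *)
Lemma code_set_closed a : (forall n, exists2 b, code_set b &
  forall i, (i < n)%N -> b i = a i) -> code_set a.
Proof.
move=> ha.
have /choice[u uP] : forall n, exists u : M * R, exists2 b, codes u.1 u.2 b &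
    forall i, (i < n)%N -> b i = a i.
  by move=> n; have [b [C [x Cx]] ba] := ha n; exists (C, x), b.
have cK : compact (S `*` [set x : R | 0 <= x <= bnd]).
  apply: compact_setX => //; rewrite -[X in compact X]/[set` `[0, bnd]].
  exact: segment_compact.
have [n|[C x] [/= SC x0] ucl] := @compact_cluster_seq R (M * R)%type _ u cK.
  by have [b [[? ?] _ _ _ _] _] := uP n; split.
have approx (k : key) e : 0 < e -> exists C' x' b, [/\ codes C' x' b,
    ball C e C', `|x - x'| < e & code_at b k = code_at a k].
  move=> e0; have [m km [um1 um2]] := ucl _ (nbhsx_ballx (C, x) e e0) (pickle k).+1.
  have [b cb ba] := uP m; exists (u m).1, (u m).2, b; split => //.
  exact: ba.
exists C, x; split => //.
- move=> n; apply/ler_addgt0Pr => e e0.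
  have [C' [x' [b [[_ h _ _ _] CC' _ E]]]] := approx (inl (inl n)) e e0.
  rewrite -E; apply: (le_trans (metric_triangle _ C' _)); rewrite lerD//.
  by move: CC'; rewrite ballEmdist /= metric_sym => /ltW.
- move=> n; apply/ler_addgt0Pr => e e0.
  have [C' [x' [b [[_ _ h _ _] _ xx' E]]]] := approx (inl (inr n)) e e0.
  rewrite -E; set r := _%:R * _; have -> : r - x = (r - x') + (x' - x) by ring.
  apply: (le_trans (ler_normD _ _)); apply: lerD; first exact: h.
  by rewrite distrC ltW.
- move=> q j; have [|xq] := leP (ratr q) x; [by left|right=> y].
  rewrite ballEmdist /= => Cy; set r := 2 ^- _ in Cy *.
  (* Small enough that [x' < ratr q] and that [y] remains in the ball around [C']. *)
  pose e := Num.min (ratr q - x) (r - mdist C y).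
  have e0 : 0 < e by rewrite lt_min !subr_gt0 xq.
  have [C' [x' [b [[_ _ _ h _] CC' xx' E]]]] := approx (inr (inl (q, j))) e e0.
  move: (h q j); rewrite E -/r => -[qx'|]; last apply.
    move: xx'; rewrite lt_min => /andP[+ _]; rewrite distrC.
    by move=> /(le_lt_trans (ler_norm _)); rewrite ltNge lerD2r qx'.
  move: CC'; rewrite !ballEmdist /= metric_sym lt_min => /andP[_ CC'].
  by apply: (le_lt_trans (metric_triangle _ C _)); rewrite -ltrBrDr.
- move=> q; have [|qx] := leP x (ratr q); [by left|right => OC].
  set j := code_at a _ in OC.
  have /nbhs_ballP[r /= r0 rO] : nbhs C (O q j) by exact: open_nbhs_nbhs.
  (* Small enough that [ratr q < x'] and that [C'] remains in [O q j]. *)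
  pose e := Num.min (x - ratr q) r.
  have e0 : 0 < e by rewrite lt_min subr_gt0 qx.
  have [C' [x' [b [[_ _ _ _ h] CC' xx' E]]]] := approx (inr (inr q)) e e0.
  move: (h q); rewrite E -/j => -[qx'|]; last first.
    by apply; apply: rO; apply: le_ball CC'; rewrite ge_min lexx orbT.
  move: xx'; rewrite lt_min => /andP[+ _].
  by move=> /(le_lt_trans (ler_norm _)); rewrite ltNge lerD2l lerN2 qx'.
Qed.

Lemma codes_close C x a C' x' b n : codes C x a -> codes C' x' b ->
  code_at a (inl (inr n)) = code_at b (inl (inr n)) -> `|x - x'| <= 2 * 2 ^- n.
Proof.
move=> [_ _ /(_ n) ha _ _] [_ _ /(_ n) hb _ _] E; move: ha hb; rewrite E.
rewrite !ler_norml => /andP[? ?] /andP[? ?]; apply/andP; split; lra.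
Qed.

Lemma codes_value_unique C x C' x' a : codes C x a -> codes C' x' a -> x = x'.
Proof.
move=> cx cx'; apply/eqP; rewrite -subr_eq0 -normr_le0.
apply/ler_addgt0Pr => e e0; have e20 : 0 < e / 2 by rewrite divr_gt0.
have [n /(_ _ (leqnn n)) ne] := half_pow_lt e20.
rewrite add0r; apply: (le_trans (codes_close (n := n) cx cx' erefl)); lra.
Qed.

(** A single entry of the code determines the value up to [2 * 2 ^- n]. *)
Lemma coded_value_continuous a e : code_set a -> 0 < e -> exists n, forall b,
  code_set b -> (forall i, (i < n)%N -> a i = b i) ->
  `|coded_value a - coded_value b| < e.
Proof.
move=> ca e0; have e20 : 0 < e / 2 by rewrite divr_gt0.
have [n /(_ _ (leqnn n)) ne] := half_pow_lt e20.
exists (pickle (inl (inr n) : key)).+1 => b cb ab.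
have [C Ca] := coded_valueP ca; have [C' Cb] := coded_valueP cb.
apply: le_lt_trans (codes_close (n := n) Ca Cb _) _; first exact: ab.
lra.
Qed.

Lemma analytic_coded_image : analytic (g @` S).
Proof.
have -> : g @` S = coded_value @` code_set.
  apply/seteqP; split=> [_ [C SC <-]|_ [a ca <-]].
    have [a ca] := ex_codes SC.
    have ca' : code_set a by exists C, (g C).
    exists a => //; have [C' C'a] := coded_valueP ca'.
    exact: codes_value_unique C'a ca.
  have [C Ca] := coded_valueP ca; exists C; first by case: Ca => -[].
  by rewrite (codes_value Ca).
apply: analytic_image_baire.
  exact: code_set_closed.
exact: coded_value_continuous.
Qed.

End CodedImage.

(** * From compact families to analytic sets *)

Section CompactToAnalytic.
Context {R : realType} {d : nat}.

(** Otherwise points of [C] within [2 ^- n] of uncovered ones cluster in [C], at a point interior to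
    some [U i]. *)
Lemma open_cover_nbhd (C : set 'rV[R]_d) (U : nat -> set 'rV[R]_d) : compact C ->
  (forall i, open (U i)) -> C `<=` \bigcup_i U i ->
  exists2 r, 0 < r & closed_nbhd C r `<=` \bigcup_i U i.
Proof.
move=> cC oU CU; apply: contrapT => nr.
have /choice[u uP] : forall n, exists x, C x /\ exists y, edist y x <= 2 ^- n /\
    ~ (\bigcup_i U i) y.
  move=> n; apply: contrapT => nx; apply: nr; exists (2 ^- n).
    by rewrite invr_gt0 exprn_gt0.
  move=> y [x Cx yx]; apply: contrapT => nU; apply: nx; exists x; split => //.
  by exists y.
have [|x Cx xcl] := @compact_cluster_seq R 'rV[R]_d C u cC.
  by move=> n; have [] := uP n.
have [i _ Uix] := CU x Cx.
have /nbhs_edistP[e e0 eU] : nbhs x (U i) by exact: open_nbhs_nbhs.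
have e20 : 0 < e / 2 by rewrite divr_gt0.
have [N NP] := half_pow_lt e20.
have [m Nm xu] := xcl _ (nbhs_edist x e20) N.
have [_ [y [yu nU]]] := uP m; apply: nU; exists i => //; apply: eU.
apply: (le_lt_trans (edist_triangle (u m) _ _)); rewrite [e]splitr ltrD//.
by rewrite edist_sym (le_lt_trans yu)// NP.
Qed.

(** The strict bound on [e] leaves room for passing to open covers, and [0 < q] keeps to exponents
    at which null sets bound the dimension. *)
Definition small_content (K : set 'rV[R]_d) (q : rat) (j : nat) : set (hyperspace K) :=
  [set C | 0 < q /\ exists2 e, e < j.+1%:R^-1 & content_le (ratr q) e (carrier C)].

(** An open cover of [C] also covers a neighbourhood of [C], hence every compact set close to [C] in
    the Hausdorff metric. *)
Lemma open_small_content K q j : open (@small_content K q j).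
Proof.
rewrite openE => C [q0 [e]]; set v : R := j.+1%:R^-1 => ej Ce; have [_ cC _] := carrierP C.
have q0R : 0 < ratr q :> R by rewrite ltr0q.
pose eta := (v - e) / 2.
have eta0 : 0 < eta by rewrite divr_gt0// subr_gt0.
have [U [r [CU oU r0 dU Sr]]] := content_le_open q0R eta0 Ce.
have [rho rho0 rhoU] := open_cover_nbhd cC oU CU.
apply/nbhs_ballP; exists rho => //= C'; rewrite ballEmdist /= => CC'.
have [s [s0 _ C's] srho] := inf_lt (hausdorff_radii_nonempty C C') CC'.
split => //; exists (e + eta); first by rewrite -/v /eta; lra.
exists U, r; split => //; last by move=> i; exact: ltW.
move=> x /C's /(closed_nbhdS (ltW srho)); exact: rhoU.
Qed.

(** Sets lying in every [small_content K q j] have dimension at most [q], the others at least [q],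
    which is the form that the coding of graphs requires. *)
Lemma analytic_of_compact_family (K : set 'rV[R]_d) (CC : set (hyperspace K)) :
  compact K -> compact CC -> analytic [set hausdorff_dim (carrier C) | C in CC].
Proof.
move=> cK cCC.
have sub (C : hyperspace K) : carrier C `<=` K by have [] := @carrierP _ _ K C.
have [[C0 CC0]|nC] := pselect (CC !=set0); last first.
  (* The empty family gives the image of the empty closed subset of the Baire space. *)
  have -> : [set hausdorff_dim (carrier C) | C in CC] =
      (fun _ : nat -> nat => 0) @` set0.
    apply/seteqP; split=> [t [C CCC _]|t [a []]].
    by exfalso; apply: nC; exists C.
  apply: analytic_image_baire => [a /(_ 0%N)[b []]|a e []].
have /choice[l lP] : forall n, exists l : seq (hyperspace K),
    forall C, CC C -> exists2 a, a \in l & ball a (2 ^- n) C.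
  by move=> n; apply: compact_net => //; rewrite invr_gt0 exprn_gt0.
apply: (@analytic_coded_image _ _ CC (fun C => hausdorff_dim (carrier C))
  (hausdorff_dim K) (@small_content K) cCC _ _ _ _ (fun n i => nth C0 (l n) i)).
- move=> C _; rewrite hausdorff_dim_ge0/=; exact: le_hausdorff_dim cK (sub C).
- exact: open_small_content.
- move=> q C _ qC; have [q0 _] := qC 0%N.
  apply: null_dim_le => [|e e0]; first by rewrite ltr0q.
  have [j je] : exists j, j.+1%:R^-1 < e.
    exists (Num.truncn e^-1); rewrite invf_plt ?posrE//.
    have e1 : 0 <= e^-1 by rewrite invr_ge0 ltW.
    by have /andP[] := truncn_itv e1.
  have [_ [e' e'j]] := qC j; apply: content_le_le.
  exact/ltW/(lt_trans e'j).
- move=> q C _ nq; rewrite leNgt; apply/negP => dq; apply: nq => j.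
  have q0 : 0 < ratr q :> R by apply: le_lt_trans dq; exact: hausdorff_dim_ge0.
  split; first by rewrite -(ltr0q R).
  exists (j.+1%:R^-1 / 2); first by rewrite gtr_pMr ?invf_lt1 ?ltr1n.
  apply: (dim_lt_null_compact cK (sub C) dq).
  by rewrite divr_gt0.
- move=> n C CCC; have [a al aC] := lP n C CCC; exists (index a (l n)).
  by rewrite nth_index//; move: aC; rewrite ballEmdist => /ltW.
Qed.

End CompactToAnalytic.

Theorem theorem4p4 (R : realType) (d : nat) (hd : (1 <= d)%N)
    (K : set 'rV[R]_d) (hK0 : K !=set0) (hK : compact K)
    (A : set R) (hA : A `<=` [set x : R | 0 <= x <= hausdorff_dim K]) :
  (exists CC : set (hyperspace K),
     compact CC /\ [set hausdorff_dim (carrier C) | C in CC] = A)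
  <-> analytic A.
Proof.
split=> [[CC [cCC <-]]|]; first exact: analytic_of_compact_family.
exact: compact_family_of_analytic.
Qed.
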